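(* Let $n\ge2$, $\kappa\in\{1,\dots,n-1\}$, let $\mathcal X_\kappa=\{x\in\{0,1\}^n: x_1+\cdots+x_n=\kappa\}$ with uniform probability measure $\mu$. For $z\in\mathcal X_\kappa$ let $J_0(z)=\{i:z_i=0\}$ and $J_1(z)=\{i:z_i=1\}$, and for $i\in J_0(z)$, $j\in J_1(z)$ let $\sigma_{ij}(z)\in\mathcal X_\kappa$ be the point with $i$-th coordinate $1$, $j$-th coordinate $0$, and all other coordinates equal to those of $z$. Let $L$ be the generator $L(z,\sigma_{ij}(z))=1$ for $(i,j)\in J_0(z)\times J_1(z)$, $L(z,z)=-\kappa(n-\kappa)$, and $L(z,w)=0$ otherwise. For all probability measures $\nu_0,\nu_1$ on $\mathcal X_\kappa$, with associated zero-temperature coupling $\widehat\pi$ and Schrödinger bridge at zero temperature $(\widehat Q_t)_{t\in[0,1]}$ from $\nu_0$ to $\nu_1$, one has for all $t\in(0,1)$ $$H(\widehat Q_t|\mu)\le(1-t)H(\nu_0|\mu)+tH(\nu_1|\mu)-\frac{t(1-t)}2\,C_t(\widehat\pi),$$ with $$C_t(\widehat\pi)=\max\Big[\frac4{\min[\kappa,n-\kappa]}W_1^2(\nu_0,\nu_1),\ \frac4{\min[\kappa,n-\kappa]}T_{c_2}(\widehat\pi),\ \widetilde T_t(\widehat\pi)\Big],$$ where $T_{c_2}(\widehat\pi)=\iint c_2(d(x,y))\,d\widehat\pi(x,y)$ with $$c_2(k)=\max\Big\{\frac{k(k-1)}2,\ k^2-2k(1+\log k)\mathbf 1_{k\ne0}\Big\},\qquad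 k\in\mathbb N,$$ and $$\widetilde T_t(\widehat\pi)=\int\max\Big[\sum_{i\in J_0(x)}h_t\big(\Pi^i_\rightarrow(x)\big),\sum_{j\in J_1(x)}h_t\big(\Pi^j_\rightarrow(x)\big)\Big]d\nu_0(x)+\int\max\Big[\sum_{i\in J_0(y)}h_{1-t}\big(\Pi^i_\leftarrow(y)\big),\sum_{j\in J_1(y)}h_{1-t}\big(\Pi^j_\leftarrow(y)\big)\Big]d\nu_1(y),$$ $$\Pi^i_\rightarrow(x)=\int\mathbf 1_{w_i\ne x_i}\,d\widehat\pi_\rightarrow(w|x),\qquad \Pi^i_\leftarrow(y)=\int\mathbf 1_{w_i\ne y_i}\,d\widehat\pi_\leftarrow(w|y).$$
   Context: The graph on $\mathcal X_\kappa$ has edges $(z,\sigma_{ij}(z))$; its graph distance is $d(x,y)=\frac12\sum_{i=1}^n\mathbf 1_{x_i\ne y_i}$. $[x,y]=\{z:d(x,z)+d(z,y)=d(x,y)\}$, $W_1(\nu_0,\nu_1)=\inf_\pi\iint d\,d\pi$ over couplings of $\nu_0,\nu_1$, and $H(q|\mu)=\sum_zq(z)\log\frac{q(z)}{\mu(z)}$ ($0\log0=0$). For $t\in(0,1)$ and $u\in[0,1]$, $h_t(u)=\frac{t\,h(u)-h(tu)}{t(1-t)}$ with $h(u)=2[(1-u)\log(1-u)+u]$. Zero-temperature coupling and bridge. For $\gamma>0$, $t\ge0$ let $P_t^\gamma=e^{\gamma tL}$ and $P_t^\gamma f(x)=\sum_yP_t^\gamma(x,y)f(y)$. Let $f^\gamma,g^\gamma\ge0$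 solve $f^\gamma(x)\,P_1^\gamma g^\gamma(x)=\nu_0(x)/\mu(x)$ and $g^\gamma(y)\,P_1^\gamma f^\gamma(y)=\nu_1(y)/\mu(y)$ for all $x,y$, and set $\widehat\pi^\gamma(x,y)=\mu(x)P_1^\gamma(x,y)f^\gamma(x)g^\gamma(y)$; this is a uniquely determined coupling of $\nu_0,\nu_1$ (the minimizer of the relative entropy with respect to $\mu(x)P_1^\gamma(x,y)$ among couplings of $\nu_0$ and $\nu_1$). It is known (Léonard) that as $\gamma\to0$, $\widehat\pi^\gamma$ converges to a coupling $\widehat\pi$ of $\nu_0,\nu_1$, which is $W_1$-optimal. The kernels are $\widehat\pi_\rightarrow(w|x)=\widehat\pi(x,w)/\nu_0(x)$ for $\nu_0(x)>0$ and $\widehat\pi_\leftarrow(w|y)=\widehat\pi(w,y)/\nu_1(y)$ for $\nu_1(y)>0$. The bridge is $\widehat Q_t(z)=\sum_{x,y}Q_t^{x,y}(z)\,\widehat\pi(x,y)$ with $Q_t^{x,y}(z)=\mathbf 1_{[x,y]}(z)\binom{d(x,y)}{d(x,z)}^{-1}t^{d(x,z)}(1-t)^{d(z,y)}$. *)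

(* Defs.v *)
From mathcomp Require Import all_boot all_order all_algebra.
From mathcomp Require Import all_classical all_reals all_analysis.
Set Implicit Arguments.
Unset Strict Implicit.
Unset Printing Implicit Defensive.
Import Order.TTheory GRing.Theory Num.Theory.
Import numFieldNormedType.Exports.
Local Open Scope classical_set_scope.
Local Open Scope ring_scope.

Definition slice (n kappa : nat) : Type :=
  {x : {ffun 'I_n -> bool} | (\sum_(i < n) x i)%N == kappa}.

Section Slice.
Context {n kappa : nat}.
Local Notation X := (slice n kappa).
Implicit Types x y z w : X.

Definition J0 z : {set 'I_n} := [set i | ~~ val z i].
Definition J1 z : {set 'I_n} := [set i | val z i].

(* sigma i j z is only used for i in J0 z and j in J1 z; it then has the same
   coordinate sum as z. *)
Definition sigma (i j : 'I_n) z : {ffun 'I_n -> bool} :=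
  [ffun k => if k == i then true else if k == j then false else val z k].

Definition edge z w : bool :=
  [exists i in J0 z, exists j in J1 z, val w == sigma i j z].

(* Two points of the slice differ at an even number of coordinates, so that
   the halving is exact. *)
Definition dist x y : nat := (\sum_(i < n) (val x i != val y i))./2.

Definition between x y z : bool := (dist x z + dist z y == dist x y)%N.

End Slice.

Section Measures.
Context {R : realType} {T : finType}.

Definition is_prob (nu : T -> R) : Prop :=
  (forall x, 0 <= nu x) /\ \sum_x nu x = 1.

Definition is_coupling (nu0 nu1 : T -> R) (pi : T -> T -> R) : Prop :=
  [/\ forall x y, 0 <= pi x y,
      forall x, \sum_y pi x y = nu0 x
    & forall y, \sum_x pi x y = nu1 y].

Definition entropy (q mu : T -> R) : R := \sum_z q z * ln (q z / mu z).

Definition unif (_ : T) : R := (#|T|%:R)^-1.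

(* If nu0 x = 0 (resp. nu1 y = 0) the kernel is 0; these values only occur
   with weight 0. *)
Definition kernel_fwd (nu0 : T -> R) (pi : T -> T -> R) (x w : T) : R :=
  pi x w / nu0 x.
Definition kernel_bwd (nu1 : T -> R) (pi : T -> T -> R) (y w : T) : R :=
  pi w y / nu1 y.

End Measures.

Definition expmx {R : realType} {m : nat} (A : 'M[R]_m) : 'M[R]_m :=
  \matrix_(a, b) limn (series (fun k => (A ^+ k) a b / k`!%:R)).

Section Bridge.
Context {R : realType} {n kappa : nat}.
Local Notation X := (slice n kappa).
Implicit Types (x y z w : X) (nu : X -> R) (pi : X -> X -> R).

Definition W1 nu0 nu1 : R :=
  inf [set c | exists2 pi, is_coupling nu0 nu1 pi &
                 c = \sum_x \sum_y (dist x y)%:R * pi x y].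

Definition gen z w : R :=
  if z == w then - (kappa * (n - kappa))%:R else (edge z w)%:R.

Definition heat (gamma t : R) x y : R :=
  expmx ((gamma * t) *: \matrix_(a < #|{: X}|, b < #|{: X}|)
                          gen (enum_val a) (enum_val b))
    (enum_rank x) (enum_rank y).

Definition heat_op (gamma t : R) (f : X -> R) x : R :=
  \sum_y heat gamma t x y * f y.

Definition schrodinger_system nu0 nu1 (gamma : R) (f g : X -> R) : Prop :=
  [/\ forall x, 0 <= f x, forall y, 0 <= g y,
      forall x, f x * heat_op gamma 1 g x = nu0 x / unif x
    & forall y, g y * heat_op gamma 1 f y = nu1 y / unif y].

Definition coupling_at (gamma : R) (f g : X -> R) x y : R :=
  unif x * heat gamma 1 x y * f x * g y.

(* For each gamma > 0 the coupling coupling_at gamma f g does not depend on the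
   chosen solution (f, g) of the system. *)
Definition zero_temp_coupling nu0 nu1 pi : Prop :=
  exists f g : R -> X -> R,
    (forall gamma, 0 < gamma ->
       schrodinger_system nu0 nu1 gamma (f gamma) (g gamma)) /\
    (forall x y,
       coupling_at gamma (f gamma) (g gamma) x y @[gamma --> 0^'+] --> pi x y).

Definition bridge_xy (t : R) x y z : R :=
  (between x y z)%:R * ('C(dist x y, dist x z)%:R)^-1
    * t ^+ dist x z * (1 - t) ^+ dist z y.

Definition bridge pi (t : R) z : R := \sum_x \sum_y bridge_xy t x y z * pi x y.

Definition h (u : R) : R := 2 * ((1 - u) * ln (1 - u) + u).

Definition ht (t u : R) : R := (t * h u - h (t * u)) / (t * (1 - t)).

Definition c2 (k : nat) : R :=
  Num.max (k%:R * (k%:R - 1) / 2)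
          (k%:R ^+ 2 - 2 * k%:R * (1 + ln k%:R) * (k != 0%N)%:R).

Definition Tc2 pi : R := \sum_x \sum_y c2 (dist x y) * pi x y.

Definition Pi_fwd nu0 pi (i : 'I_n) x : R :=
  \sum_(w : X) (val w i != val x i)%:R * kernel_fwd nu0 pi x w.

Definition Pi_bwd nu1 pi (i : 'I_n) y : R :=
  \sum_(w : X) (val w i != val y i)%:R * kernel_bwd nu1 pi y w.

Definition Ttilde nu0 nu1 (t : R) pi : R :=
  \sum_x Num.max (\sum_(i in J0 x) ht t (Pi_fwd nu0 pi i x))
                 (\sum_(j in J1 x) ht t (Pi_fwd nu0 pi j x)) * nu0 x
  + \sum_y Num.max (\sum_(i in J0 y) ht (1 - t) (Pi_bwd nu1 pi i y))
                   (\sum_(j in J1 y) ht (1 - t) (Pi_bwd nu1 pi j y)) * nu1 y.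

Definition Ct nu0 nu1 (t : R) pi : R :=
  Num.max (4 / (minn kappa (n - kappa))%:R * W1 nu0 nu1 ^+ 2)
    (Num.max (4 / (minn kappa (n - kappa))%:R * Tc2 pi)
             (Ttilde nu0 nu1 t pi)).

End Bridge.

(* Main.v *)
(* Write k = d(x,z) and l = d(z,y).  As gamma -> 0 the heat kernel behaves like
   gamma^d(x,y) d(x,y)! (there are (d!)^2 geodesics), so exchanging the end
   points y, y' of two pairs (x,y), (x',y') in the Schroedinger coupling gives
   in the limit both d-cyclical monotonicity and a product formula for
   pi/d!.  Consequently the two end points of the bridge are independent given
   its position z at time t.  Since k! l! t^k (1-t)^l is compatible with
   single-edge moves, the first two time derivatives of the bridge are sums of
   fluxes along edges and along squares z, w, w', v.  On every square
   q ln (q / a) >= q - a bounds the second derivative of the entropy from below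
   by the products of two rates that share a coordinate.  Cauchy-Schwarz,
   together with the fact that a coordinate cannot both have moved and still have to
   move, gives the W_1 and c_2 bounds: c_2(k) <= k (k-1), the latter being the
   mean of k l / (t (1-t)).  Applied conditionally on an end point instead, it
   gives the second derivative of h (t Pi^i).  The claim follows by convexity
   of the entropy minus the respective comparison function. *)
Require Import Defs.
From mathcomp Require Import all_boot all_order all_algebra all_fingroup.
From mathcomp Require Import all_classical all_reals all_analysis.
From mathcomp Require Import ring lra zify.
Set Implicit Arguments.
Unset Strict Implicit.
Unset Printing Implicit Defensive.
Import Order.TTheory GRing.Theory Num.Theory.
Import numFieldNormedType.Exports.
Local Open Scope ring_scope.

(** The curvature is what an exact cancellation leaves over. Let [F] and [B] be the total forward
    and backward fluxes at a point of mass [Q]. If the tangent bound ran over all ordered pairs of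
    moves, the squares would contribute [(2 B F - F^2 - B^2) / Q] per point; the squared first
    derivative contributes [(B - F)^2 / Q], and the sum is 0. But a square needs two moves with
    different raised and different lowered coordinates, so the pairs sharing a coordinate are never
    subtracted and remain with a good sign.

    Two choices keep this exact. Moves are transpositions of coordinates, defined at every point, so
    that sums over points can be reindexed freely while inadmissible moves merely have rate 0. Means
    are not normalised by [Q], so that points of mass 0 contribute 0 under the convention
    [x / 0 = 0].

    The comparison functions are dictated by the claim: [h'' u = 2 / (1 - u)], and
    [t (1 - t) h_t(u)] is the convexity gap of [s |-> h (s u)] at [t]. *)

(** * Geometry of the slice: distance, geodesics and moves *)

Section Geometry.
Variables (n kappa : nat).
Local Notation X := (slice n kappa).
Implicit Types (x y z w : X) (e : 'I_n * 'I_n).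

Lemma slice_sum x : (\sum_(i < n) val x i)%N = kappa.
Proof. exact/eqP/(valP x). Qed.

Lemma slice_ext x y : val x =1 val y -> x = y.
Proof. by move=> xy; apply/val_inj/ffunP. Qed.

(** Both points have [kappa] ones, so gains and losses balance; this is what makes the halving in
    [dist] exact. *)
Lemma dist_gain_loss x y :
  dist x y = (\sum_(i < n) (~~ val x i && val y i))%N /\
  dist x y = (\sum_(i < n) (val x i && ~~ val y i))%N.
Proof.
have bal : (\sum_(i < n) (~~ val x i && val y i) =
            \sum_(i < n) (val x i && ~~ val y i))%N.
  have sxy : (\sum_(i < n) val x i = \sum_(i < n) val y i)%N.
    by rewrite !slice_sum.
  apply: (@addIn (\sum_(i < n) val x i)%N); rewrite {2}sxy -!big_split /=.
  by apply: eq_bigr => i _; case: (val x i); case: (val y i).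
suff -> : dist x y = (\sum_(i < n) (~~ val x i && val y i))%N by rewrite {2}bal.
rewrite /dist -[RHS]doubleK -addnn {2}bal -big_split /=; congr _./2.
by apply: eq_bigr => i _; case: (val x i); case: (val y i).
Qed.

Lemma dist_gain x y : dist x y = (\sum_(i < n) (~~ val x i && val y i))%N.
Proof. by have [] := dist_gain_loss x y. Qed.

Lemma dist_loss x y : dist x y = (\sum_(i < n) (val x i && ~~ val y i))%N.
Proof. by have [] := dist_gain_loss x y. Qed.

Lemma double_dist x y : (dist x y).*2 = (\sum_(i < n) (val x i != val y i))%N.
Proof.
rewrite -addnn {1}dist_gain dist_loss -big_split /=.
by apply: eq_bigr => i _; case: (val x i); case: (val y i).
Qed.

Lemma distC x y : dist x y = dist y x.
Proof.
by rewrite dist_gain dist_loss; apply: eq_bigr => i _; rewrite andbC.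
Qed.

Lemma distxx x : dist x x = 0%N.
Proof. by rewrite dist_gain big1 // => i _; case: (val x i). Qed.

Lemma dist_eq0 x y : (dist x y == 0%N) = (x == y).
Proof.
apply/idP/eqP => [|->]; last by rewrite distxx.
rewrite -double_eq0 double_dist sum_nat_eq0 => /forallP xy.
apply: slice_ext => i; have := xy i; rewrite /= eqb0 negbK => /eqP //.
Qed.

Lemma dist_gain_gt0 x y i : ~~ val x i && val y i -> (0 < dist x y)%N.
Proof. by move=> xy; rewrite dist_gain (bigD1 i) //= xy. Qed.

Lemma dist_loss_gt0 x y i : val x i && ~~ val y i -> (0 < dist x y)%N.
Proof. by move=> xy; rewrite dist_loss (bigD1 i) //= xy. Qed.

Lemma dist_triangle_eq x y z :
  (dist x y <= dist x z + dist z y ?=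
   iff [forall i, (val x i == val y i) ==> (val z i == val x i)])%N.
Proof.
have /leqif_sum: forall i : 'I_n, true ->
    ((val x i != val y i) <= (val x i != val z i) + (val z i != val y i) ?=
     iff ((val x i == val y i) ==> (val z i == val x i)))%N.
  by move=> i _; case: (val x i); case: (val y i); case: (val z i); split.
rewrite big_split /= -!double_dist -doubleD => -[le eq]; split.
  by rewrite leq_double in le.
by rewrite -eq -!addnn; apply/eqP/eqP; lia.
Qed.

Lemma dist_triangle x y z : (dist x y <= dist x z + dist z y)%N.
Proof. by have [] := dist_triangle_eq x y z. Qed.

Lemma betweenP x y z :
  reflect (forall i, val x i = val y i -> val z i = val x i) (between x y z).
Proof.
rewrite /between eq_sym; have [_ ->] := dist_triangle_eq x y z.
apply: (iffP forallP) => H i; first by move/eqP => xy; apply/eqP/(implyP (H i))/xy.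
by apply/implyP => /eqP /H ->.
Qed.

Lemma between_sym x y z : between x y z = between y x z.
Proof. by rewrite /between addnC (distC x z) (distC z y) (distC x y). Qed.

Lemma between_dist x y z : between x y z -> dist x y = (dist x z + dist z y)%N.
Proof. by move/eqP. Qed.

Fact swap_subproof e z :
  (\sum_(i < n) [ffun k => val z (tperm e.1 e.2 k)] i)%N == kappa.
Proof.
apply/eqP; transitivity (\sum_(i < n) val z i)%N; last exact: slice_sum.
rewrite (reindex_inj (@perm_inj _ (tperm e.1 e.2))) /=.
by apply: eq_bigr => i _; rewrite ffunE tpermK.
Qed.

(** Unlike [sigma], a transposition is defined at every point, stays in the slice and is an
    involution, so it can serve to reindex sums over the slice. *)
Definition swap e z : X :=
  exist (fun x : {ffun 'I_n -> bool} => (\sum_(i < n) x i)%N == kappa)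
    _ (swap_subproof e z).

Definition flip e := (e.2, e.1).

Lemma flipK : involutive flip. Proof. by case. Qed.

Lemma swapE e z k : val (swap e z) k = val z (tperm e.1 e.2 k).
Proof. by rewrite /= ffunE. Qed.

Lemma swapK e : involutive (swap e).
Proof. by move=> z; apply: slice_ext => k; rewrite !swapE tpermK. Qed.

Lemma swap_inj e : injective (swap e).
Proof. exact: can_inj (swapK e). Qed.

Lemma swap_flip e z : swap (flip e) z = swap e z.
Proof. by apply: slice_ext => k; rewrite !swapE tpermC. Qed.

(* the move [swap e z] raises coordinate [e.1], lowers coordinate [e.2] and
   brings [z] closer to [y] *)
Definition toward e z y : bool :=
  [&& ~~ val z e.1, val y e.1, val z e.2 & ~~ val y e.2].

Lemma toward_swap e z y : toward e z y ->
  [/\ val (swap e z) e.1, ~~ val (swap e z) e.2 &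
      forall k, k != e.1 -> k != e.2 -> val (swap e z) k = val z k].
Proof.
case/and4P => z1 y1 z2 y2; split.
- by rewrite swapE tpermL.
- by rewrite swapE tpermR.
- by move=> k k1 k2; rewrite swapE tpermD // eq_sym.
Qed.

Lemma toward_dist e z y : toward e z y -> dist z y = (dist (swap e z) y).+1.
Proof.
move=> zy; have [w1 w2 wk] := toward_swap zy; have /and4P[z1 y1 z2 y2] := zy.
rewrite !dist_gain (bigD1 e.1) //= [X in _ = X.+1](bigD1 e.1) //= z1 y1 w1.
rewrite add1n add0n; congr _.+1; apply: eq_bigr => k k1.
have [->|k2] := eqVneq k e.2; last by rewrite wk.
by rewrite (negPf y2) !andbF.
Qed.

(** On a geodesic from [x] to [y], a coordinate that still has to change has its value at [x]; hence
    undoing a step towards [y] is a step towards [x]. *)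
Lemma toward_transfer x y z e : between x y z -> toward e z y ->
  [/\ between x y (swap e z), toward (flip e) (swap e z) x &
      dist x (swap e z) = (dist x z).+1].
Proof.
move=> bz zy; have [w1 w2 wk] := toward_swap zy; have /and4P[z1 y1 z2 y2] := zy.
have x1 : ~~ val x e.1.
  by apply: contraNN z1 => x1; rewrite ((betweenP _ _ _ bz)) // y1 x1.
have x2 : val x e.2.
  apply: contraTT z2 => x2.
  by rewrite ((betweenP _ _ _ bz)) ?(negPf y2) ?(negPf x2).
have wx : toward (flip e) (swap e z) x by rewrite /toward /= w2 x2 w1 x1.
have dwx : dist x (swap e z) = (dist x z).+1.
  by rewrite distC (toward_dist wx) swap_flip swapK distC.
split => //; rewrite /between dwx (between_dist bz) (toward_dist zy).
by rewrite addSnnS.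
Qed.

Lemma swap_swapC e e' z :
  e.1 != e'.1 -> e.1 != e'.2 -> e.2 != e'.1 -> e.2 != e'.2 ->
  swap e' (swap e z) = swap e (swap e' z).
Proof.
case: e e' => i j [i' j'] /= h1 h2 h3 h4; apply: slice_ext => k; rewrite !swapE /=.
congr (val z _).
by do !case: tpermP => //; move=> *; subst; rewrite ?eqxx in h1 h2 h3 h4.
Qed.

(** A coordinate already brought to its value at [y] is not touched again. The right-hand side is
    symmetric in the two moves, so their order is immaterial. *)
Lemma toward2P e e' z y :
  toward e z y && toward e' (swap e z) y =
  [&& toward e z y, toward e' z y, e.1 != e'.1 & e.2 != e'.2].
Proof.
have [zy|//] := boolP (toward e z y); rewrite /=.
have [w1 w2 wk] := toward_swap zy; have /and4P[z1 y1 z2 y2] := zy.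
have [h1|h1] := eqVneq e.1 e'.1; first by rewrite /toward -h1 w1 andbF.
have [h2|h2] := eqVneq e.2 e'.2.
  by rewrite /toward -h2 (negPf w2) !andbF.
rewrite !andbT /toward.
have [h3|h3] := eqVneq e'.1 e.2; first by rewrite h3 (negPf y2) !andbF.
have [h4|h4] := eqVneq e'.2 e.1; first by rewrite h4 y1 !andbF.
by rewrite !wk // eq_sym.
Qed.

Lemma toward2C e e' z y : toward e z y -> toward e' (swap e z) y ->
  swap e' (swap e z) = swap e (swap e' z).
Proof.
move=> zy wy; have := toward2P e e' z y; rewrite zy wy => /esym /and4P[_ zy' h1 h2].
have /and4P[z1 y1 z2 y2] := zy; have /and4P[z1' y1' z2' y2'] := zy'.
apply: swap_swapC => //; first by apply: contraNneq z1 => ->.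
by apply: contraTneq z2 => ->.
Qed.

End Geometry.

(** * Jump rates of the bridge between two fixed points and their reversibility *)

Section Rates.
Variables (R : realType) (n kappa : nat).
Local Notation X := (slice n kappa).
Implicit Types (x y z w : X) (e : 'I_n * 'I_n) (s t : R).

(* Intensity of the move [e] at [z] for a walk that reaches [y] after the
   remaining time [s]. *)
Definition rate s e z y : R := (toward e z y)%:R / ((dist z y)%:R * s).

Lemma rate_ge0 s e z y : 0 <= s -> 0 <= rate s e z y.
Proof. by move=> s0; rewrite divr_ge0 // mulr_ge0. Qed.

Lemma rate_eq0 s e z y : ~~ toward e z y -> rate s e z y = 0.
Proof. by rewrite /rate => /negPf ->; rewrite mul0r. Qed.

(** A coordinate to be raised has [dist z y] possible partners, which cancels the denominator of
    [rate]: every coordinate still to change does so at rate [1 / s]. *)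
Lemma sum_rate_row s i z y :
  \sum_j rate s (i, j) z y = (~~ val z i && val y i)%:R / s.
Proof.
rewrite -mulr_suml.
have -> : \sum_j (toward (i, j) z y)%:R =
          (~~ val z i && val y i)%:R * (dist z y)%:R :> R.
  rewrite dist_loss natr_sum mulr_sumr; apply: eq_bigr => j _.
  by rewrite -natrM mulnb /toward /= andbA.
have [zy|] := boolP (~~ val z i && val y i); last by rewrite !mul0r.
have := dist_gain_gt0 zy; rewrite -(ltr_nat R) => d0.
by rewrite mul1r invfM mulrA divff ?gt_eqF.
Qed.

Lemma sum_rate_col s j z y :
  \sum_i rate s (i, j) z y = (val z j && ~~ val y j)%:R / s.
Proof.
rewrite -mulr_suml.
have -> : \sum_i (toward (i, j) z y)%:R =
          (val z j && ~~ val y j)%:R * (dist z y)%:R :> R.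
  rewrite dist_gain natr_sum mulr_sumr; apply: eq_bigr => i _.
  by rewrite -natrM mulnb /toward /= andbA andbC.
have [zy|] := boolP (val z j && ~~ val y j); last by rewrite !mul0r.
have := dist_loss_gt0 zy; rewrite -(ltr_nat R) => d0.
by rewrite mul1r invfM mulrA divff ?gt_eqF.
Qed.

Lemma sum_rate s z y : \sum_e rate s e z y = (dist z y)%:R / s.
Proof.
transitivity (\sum_i \sum_j rate s (i, j) z y).
  by rewrite pair_big /=; apply: eq_bigr => -[].
under eq_bigr => i _ do rewrite sum_rate_row.
by rewrite -mulr_suml -natr_sum -dist_gain.
Qed.

Lemma bridge_xy_ge0 t x y z : 0 <= t <= 1 -> 0 <= bridge_xy t x y z.
Proof.
by case/andP => t0 t1; rewrite /bridge_xy !mulr_ge0 ?exprn_ge0 ?subr_ge0.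
Qed.

Lemma bridge_xy0 t x y z : ~~ between x y z -> bridge_xy t x y z = 0.
Proof. by rewrite /bridge_xy => /negPf ->; rewrite !mul0r. Qed.

(** In this form the weight is a function of [x, z] times a function of [z, y], up to [1 / d(x,y)!],
    which is the factor attached to [pi] in [switching]. *)
Lemma bridge_xy_fact t x y z : between x y z -> bridge_xy t x y z =
  (dist x z)`!%:R * (dist z y)`!%:R / (dist x y)`!%:R
   * t ^+ dist x z * (1 - t) ^+ dist z y.
Proof.
move=> bz; rewrite /bridge_xy bz mul1r; congr (_ * _ * _).
have le : (dist x z <= dist x y)%N by rewrite (between_dist bz) leq_addr.
have := bin_fact le.
rewrite {2}(between_dist bz) addKn => <-.
rewrite !natrM.
have f1 : (dist x z)`!%:R != 0 :> R by rewrite pnatr_eq0 -lt0n fact_gt0.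
have f2 : (dist z y)`!%:R != 0 :> R by rewrite pnatr_eq0 -lt0n fact_gt0.
have f3 : 'C(dist x y, dist x z)%:R != 0 :> R by rewrite pnatr_eq0 -lt0n bin_gt0.
by field; rewrite f1 f2 f3.
Qed.

Lemma bridge_xy_rev t x y z : bridge_xy (1 - t) y x z = bridge_xy t x y z.
Proof.
have [bz|bz] := boolP (between x y z); last first.
  by rewrite !bridge_xy0 // between_sym.
have bz' : between y x z by rewrite between_sym.
rewrite !bridge_xy_fact // (distC y z) (distC z x) (distC y x).
by rewrite (_ : 1 - (1 - t) = t); ring.
Qed.

(** Detailed balance. With [k = d(x,z)], [l = d(z,y)], [d = d(x,y)], both sides equal
    [k! (l-1)! t^k (1-t)^(l-1) / d!] for an admissible move and vanish otherwise. *)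
Lemma bridge_transfer t x y z e : 0 < t < 1 ->
  bridge_xy t x y z * rate (1 - t) e z y =
  bridge_xy t x y (swap e z) * rate t (flip e) (swap e z) x.
Proof.
case/andP => t0 t1.
have [/andP[bz zy]|no] := boolP (between x y z && toward e z y); last first.
  have [/andP[bw wx]|no'] :=
      boolP (between x y (swap e z) && toward (flip e) (swap e z) x).
    rewrite between_sym in bw; have [] := toward_transfer bw wx.
    by rewrite swap_flip swapK flipK between_sym => bz zy _; rewrite bz zy in no.
  transitivity (0 : R); last apply/esym.
    by case/nandP: no => [/bridge_xy0|/rate_eq0] ->; rewrite ?(mul0r, mulr0).
  by case/nandP: no' => [/bridge_xy0|/rate_eq0] ->; rewrite ?(mul0r, mulr0).
have [bw wx dw] := toward_transfer bz zy; have dz := toward_dist zy.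
rewrite /rate zy wx !bridge_xy_fact // (distC _ x) dw dz !factS !exprS.
rewrite (natrM _ _.+1) [in RHS](natrM _ _.+1).
have f : (dist x y)`!%:R != 0 :> R by rewrite pnatr_eq0 -lt0n fact_gt0.
have f1 : (dist x z).+1%:R != 0 :> R by rewrite pnatr_eq0.
have f2 : (dist (swap e z) y).+1%:R != 0 :> R by rewrite pnatr_eq0.
move: f f1 f2; move: (_.+1%:R) (_.+1%:R) (_`!%:R) => a b c c0 a0 b0.
by field; rewrite a0 b0 c0 !gt_eqF // subr_gt0.
Qed.

End Rates.

(** What survives at zero temperature of the product form [f(x) g(y)]: the last clause is the
    vanishing of 2 by 2 minors of [pi / d!], restricted to exchanges that keep the total
    distance. *)
Definition switching (R : realType) (n kappa : nat)
    (pi : slice n kappa -> slice n kappa -> R) : Prop :=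
  [/\ forall x y, 0 <= pi x y,
      forall x y x' y', 0 < pi x y -> 0 < pi x' y' ->
        (dist x y + dist x' y' <= dist x y' + dist x' y)%N
    & forall x y x' y',
        (dist x y + dist x' y' = dist x y' + dist x' y)%N ->
        pi x y / (dist x y)`!%:R * (pi x' y' / (dist x' y')`!%:R) =
        pi x y' / (dist x y')`!%:R * (pi x' y / (dist x' y)`!%:R)].

Lemma switching_tr (R : realType) (n kappa : nat)
    (pi : slice n kappa -> slice n kappa -> R) :
  switching pi -> switching (fun x y => pi y x).
Proof.
case=> pi0 pimon piswap; split => [x y|x y x' y' h h'|x y x' y' h].
- exact: pi0.
- rewrite !(distC _ y) !(distC _ y') [leqRHS]addnC.
  exact: pimon.
- rewrite !(distC _ y) !(distC _ y') [RHS]mulrC.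
  by apply: piswap; rewrite !(distC y) !(distC y') h addnC.
Qed.

(** * Averages over end points, fluxes along edges and squares *)

Section Mean.
Variables (R : realType) (n kappa : nat).
Local Notation X := (slice n kappa).
Implicit Types (x y z w : X) (e : 'I_n * 'I_n).
Variables (pi : X -> X -> R) (t : R).

(* [mean z F] is the integral of [F] over the end points of the bridges that
   sit at [z] at time [t]; it is not normalised by the mass [bridge pi t z]. *)
Definition mean z (F : X -> X -> R) : R :=
  \sum_(p : X * X) bridge_xy t p.1 p.2 z * pi p.1 p.2 * F p.1 p.2.

Lemma eq_mean z F G :
  (forall x y, between x y z -> F x y = G x y) -> mean z F = mean z G.
Proof.
move=> FG; apply: eq_bigr => -[x y] _ /=.
have [b|b] := boolP (between x y z); first by rewrite FG.
by rewrite bridge_xy0 // !mul0r.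
Qed.

Lemma mean1 z : mean z (fun _ _ => 1) = bridge pi t z.
Proof.
by rewrite /mean /bridge pair_big /=; apply: eq_bigr => p _; rewrite mulr1.
Qed.

Lemma meanD z F G : mean z F + mean z G = mean z (fun x y => F x y + G x y).
Proof. by rewrite /mean -big_split; apply: eq_bigr => p _; rewrite mulrDr. Qed.

Lemma meanB z F G : mean z F - mean z G = mean z (fun x y => F x y - G x y).
Proof. by rewrite /mean -sumrB; apply: eq_bigr => p _; rewrite mulrBr. Qed.

Lemma meanZ z F a : mean z F * a = mean z (fun x y => F x y * a).
Proof. by rewrite /mean mulr_suml; apply: eq_bigr => p _; rewrite mulrA. Qed.

Lemma mean_sum z (I : finType) (F : I -> X -> X -> R) :
  \sum_i mean z (F i) = mean z (fun x y => \sum_i F i x y).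
Proof.
by rewrite /mean exchange_big; apply: eq_bigr => p _; rewrite mulr_sumr.
Qed.

Lemma sum_mean (F : X -> X -> X -> R) :
  \sum_z mean z (F z) =
  \sum_(p : X * X) pi p.1 p.2 * \sum_z bridge_xy t p.1 p.2 z * F z p.1 p.2.
Proof.
rewrite /mean exchange_big; apply: eq_bigr => p _; rewrite mulr_sumr.
by apply: eq_bigr => z _; ring.
Qed.

Hypothesis t01 : 0 < t < 1.

Lemma time_le01 : 0 <= t <= 1.
Proof. by case/andP: t01 => /ltW-> /ltW->. Qed.

Lemma time_gt0 : 0 < t. Proof. by case/andP: t01. Qed.
Lemma time_lt1 : 0 < 1 - t. Proof. by rewrite subr_gt0; case/andP: t01. Qed.

Local Hint Resolve time_le01 time_gt0 time_lt1 : core.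

Lemma mean_step z e (G : X -> X -> R) :
  mean z (fun x y => rate (1 - t) e z y * G x y) =
  mean (swap e z) (fun x y => rate t (flip e) (swap e z) x * G x y).
Proof.
by apply: eq_bigr => -[x y] _ /=; rewrite mulrACA bridge_transfer // mulrACA.
Qed.

Hypothesis swpi : switching pi.

Lemma mean_ge0 z F : (forall x y, 0 <= F x y) -> 0 <= mean z F.
Proof.
move=> F0; have [pi0 _ _] := swpi.
apply: sumr_ge0 => p _; apply: mulr_ge0 => //; apply: mulr_ge0 => //.
exact: bridge_xy_ge0.
Qed.

Lemma bridge_ge0 z : 0 <= bridge pi t z.
Proof. by rewrite -mean1 mean_ge0. Qed.

Lemma mean_bridge0 z F : bridge pi t z = 0 -> mean z F = 0.
Proof.
have [pi0 _ _] := swpi.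
rewrite -mean1 /mean => /eqP; rewrite psumr_eq0 => [/allP H|p _]; last first.
  by rewrite mulr1; apply: mulr_ge0 => //; apply: bridge_xy_ge0.
rewrite big1 // => p _; have /eqP := H p (mem_index_enum p).
by rewrite mulr1 => ->; rewrite mul0r.
Qed.

Lemma bridge_gt0 z F : mean z F != 0 -> 0 < bridge pi t z.
Proof.
move=> m0; rewrite lt0r bridge_ge0 andbT.
by apply: contraNneq m0 => /mean_bridge0 ->.
Qed.

(** Going through the common point [z], the crossed pairs have total distance at most that of the
    original pairs; monotonicity gives the converse. So equality holds, [z] lies between the crossed
    pairs too, and the switching relation applies. *)
Let switch_weight x y x' y' z :
  bridge_xy t x y z * pi x y * (bridge_xy t x' y' z * pi x' y') != 0 ->
  bridge_xy t x y z * pi x y * (bridge_xy t x' y' z * pi x' y') =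
  bridge_xy t x y' z * pi x y' * (bridge_xy t x' y z * pi x' y).
Proof.
have [pi0 pimon piswap] := swpi.
move=> n0.
have b : between x y z.
  by apply: contraNT n0 => nb; rewrite bridge_xy0 // !mul0r.
have b' : between x' y' z.
  by apply: contraNT n0 => nb; rewrite (bridge_xy0 _ nb) !(mul0r, mulr0).
have p : pi x y != 0 by apply: contraNneq n0 => ->; rewrite mulr0 mul0r.
have p' : pi x' y' != 0 by apply: contraNneq n0 => ->; rewrite !mulr0.
have le : (dist x y + dist x' y' <= dist x y' + dist x' y)%N.
  by apply: pimon; rewrite lt0r ?p ?p' pi0.
have tri1 := dist_triangle x y' z; have tri2 := dist_triangle x' y z.
have := between_dist b; have := between_dist b' => d' d.
have c : between x y' z by apply/eqP; lia.
have c' : between x' y z by apply/eqP; lia.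
rewrite !bridge_xy_fact //.
have /piswap sw : (dist x y + dist x' y' = dist x y' + dist x' y)%N by lia.
pose A := (dist x z)`!%:R * (dist z y)`!%:R * (dist x' z)`!%:R
  * (dist z y')`!%:R * t ^+ dist x z * t ^+ dist x' z
  * (1 - t) ^+ dist z y * (1 - t) ^+ dist z y' : R.
transitivity (A * (pi x y / (dist x y)`!%:R * (pi x' y' / (dist x' y')`!%:R))).
  by rewrite /A; ring.
by rewrite sw /A; ring.
Qed.

Lemma weight_switch x y x' y' z :
  bridge_xy t x y z * pi x y * (bridge_xy t x' y' z * pi x' y') =
  bridge_xy t x y' z * pi x y' * (bridge_xy t x' y z * pi x' y).
Proof.
have [l0|/switch_weight //] := eqVneq
  (bridge_xy t x y z * pi x y * (bridge_xy t x' y' z * pi x' y')) 0.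
have [r0|/switch_weight //] := eqVneq
  (bridge_xy t x y' z * pi x y' * (bridge_xy t x' y z * pi x' y)) 0.
by rewrite l0 r0.
Qed.

(* Given the position at time [t], the two end points are independent, because
   the switching relation lets [y] and [y'] trade places in the product. *)
Lemma mean_indep z (F G : X -> R) :
  mean z (fun x _ => F x) * mean z (fun _ y => G y) =
  bridge pi t z * mean z (fun x y => F x * G y).
Proof.
rewrite -mean1 /mean mulrC !big_distrlr /= !pair_big /=.
pose s (q : (X * X) * (X * X)) := ((q.1.1, q.2.2), (q.2.1, q.1.2)).
have sK : involutive s by case=> -[? ?] [? ?].
rewrite (reindex_inj (inv_inj sK)) /=; apply: eq_bigr => -[[x y] [x' y']] _ /=.
transitivity (bridge_xy t x y' z * pi x y' * (bridge_xy t x' y z * pi x' y)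
  * (F x' * G y')); first by ring.
by rewrite -weight_switch; ring.
Qed.

(* total rate of the forward move [e] out of [z], and of the time-reversed
   move undoing [e] at [z] *)
Definition fwd z e : R := mean z (fun _ y => rate (1 - t) e z y).
Definition bwd z e : R := mean z (fun x _ => rate t (flip e) z x).

Lemma fwd_ge0 z e : 0 <= fwd z e.
Proof. by apply: mean_ge0 => _ y; rewrite rate_ge0 // ltW. Qed.

Lemma bwd_ge0 z e : 0 <= bwd z e.
Proof. by apply: mean_ge0 => x _; rewrite rate_ge0 // ltW. Qed.

Lemma fwd_bwd z e : fwd z e = bwd (swap e z) e.
Proof.
rewrite /fwd /bwd -[LHS](eq_mean (F := fun x y => rate (1 - t) e z y * 1)).
  by rewrite mean_step; apply: eq_mean => *; rewrite mulr1.
by move=> *; rewrite mulr1.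
Qed.

Definition fwd2 z e e' : R :=
  mean z (fun _ y => rate (1 - t) e z y * rate (1 - t) e' (swap e z) y).

Lemma fwd2_ge0 z e e' : 0 <= fwd2 z e e'.
Proof. by apply: mean_ge0 => _ y; rewrite mulr_ge0 ?rate_ge0 // ltW. Qed.

(** The denominators see only the distance before each move, and admissibility of the pair is
    symmetric by [toward2P]. *)
Lemma rate2C (s : R) z y e e' :
  rate s e z y * rate s e' (swap e z) y =
  rate s e' z y * rate s e (swap e' z) y.
Proof.
have h (a b : 'I_n * 'I_n) : rate s a z y * rate s b (swap a z) y =
  [&& toward a z y, toward b z y, a.1 != b.1 & a.2 != b.2]%:R
   / ((dist z y)%:R * s) / ((dist z y).-1%:R * s).
  rewrite -toward2P; have [zy|zy] := boolP (toward a z y); last first.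
    by rewrite rate_eq0 // !mul0r.
  by rewrite /rate zy (toward_dist zy) /=; ring.
rewrite !h; congr (_%:R / _ / _); congr nat_of_bool.
by rewrite andbCA (eq_sym e.1) (eq_sym e.2).
Qed.

Lemma fwd2C z e e' : fwd2 z e e' = fwd2 z e' e.
Proof. by apply: eq_mean => x y _; rewrite rate2C. Qed.

(** The flux through a path of two moves can be read at any of its points: detailed balance shifts
    the base point by one move at a time, turning a forward rate into a backward one. *)
Lemma fwd2_mid z e e' : fwd2 z e e' =
  mean (swap e z) (fun x y => rate t (flip e) (swap e z) x
                              * rate (1 - t) e' (swap e z) y).
Proof. by rewrite /fwd2 mean_step. Qed.

Lemma fwd2_end z e e' : let v := swap e' (swap e z) in fwd2 z e e' =
  mean v (fun x _ => rate t (flip e') v x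
                     * rate t (flip e) (swap (flip e') v) x).
Proof.
rewrite /= fwd2_mid swap_flip swapK.
transitivity (mean (swap e z) (fun x y => rate (1 - t) e' (swap e z) y
    * rate t (flip e) (swap e z) x)).
  by apply: eq_mean => x y _; rewrite mulrC.
by rewrite mean_step.
Qed.

Lemma fwd2_neq0 z e e' : fwd2 z e e' != 0 ->
  [/\ swap e' (swap e z) = swap e (swap e' z), e.1 != e'.1 & e.2 != e'.2].
Proof.
rewrite /fwd2 => m0.
have [p] : exists p : X * X, toward e z p.2 && toward e' (swap e z) p.2.
  apply: contra_neqP m0 => no; rewrite /mean big1 // => p _.
  have [h|h] := boolP (toward e z p.2 && toward e' (swap e z) p.2).
    by case: no; exists p.
  by case/nandP: h => [/rate_eq0|/rate_eq0] ->; rewrite ?(mul0r, mulr0).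
case/andP => h h'; split; first exact: (toward2C h h').
  by have := toward2P e e' z p.2; rewrite h h' => /esym/and4P[].
by have := toward2P e e' z p.2; rewrite h h' => /esym/and4P[].
Qed.

(** Both factors are fluxes seen from the middle point [swap e z], one into it and one out of it;
    independence of past and future there turns their product into the flux through the path. *)
Lemma fwd_bwd_fwd2 z e e' :
  fwd z e * bwd (swap e' (swap e z)) e' =
  bridge pi t (swap e z) * fwd2 z e e'.
Proof.
rewrite -(fwd_bwd (swap e z)) fwd_bwd fwd2_mid.
exact: (mean_indep (swap e z) (rate t (flip e) (swap e z))).
Qed.

(** The first move lowers the distance by one, whence [d (d - 1)], the same numerator as in the
    second derivative of a power. *)
Lemma sum_rate2 (s : R) z y :
  \sum_e \sum_e' rate s e z y * rate s e' (swap e z) y =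
  (dist z y)%:R * ((dist z y)%:R - 1) / s ^+ 2.
Proof.
transitivity (\sum_e rate s e z y * (((dist z y)%:R - 1) / s)).
  apply: eq_bigr => e _; rewrite -mulr_sumr sum_rate.
  have [zy|zy] := boolP (toward e z y); last by rewrite rate_eq0 // !mul0r.
  by rewrite (toward_dist zy) -natr1 addrK.
by rewrite -mulr_suml sum_rate expr2 invfM; ring.
Qed.

Definition fdist z y : R := (dist z y)%:R.

Lemma sum_fwd z : \sum_e fwd z e = mean z (fun _ y => fdist z y / (1 - t)).
Proof. by rewrite mean_sum; apply: eq_mean => x y _; rewrite sum_rate. Qed.

Lemma sum_flip (F : 'I_n * 'I_n -> R) : \sum_e F (flip e) = \sum_e F e.
Proof. by rewrite [RHS](reindex_inj (inv_inj (@flipK n))). Qed.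

Lemma sum_bwd z : \sum_e bwd z e = mean z (fun x _ => fdist x z / t).
Proof.
rewrite mean_sum; apply: eq_mean => x y _.
by rewrite (sum_flip (fun e => rate t e z x)) sum_rate distC.
Qed.

(** Each term of the second difference in [sum_accel] is evaluated by reading the flux at the corner
    where [f] is taken; there the sum over moves collapses to a function of distances. *)
Lemma sum_fwd2_start (f : X -> R) :
  \sum_z \sum_e \sum_e' fwd2 z e e' * f z =
  \sum_z mean z (fun _ y =>
    fdist z y * (fdist z y - 1) / (1 - t) ^+ 2) * f z.
Proof.
apply: eq_bigr => z _; under eq_bigr => e _ do rewrite -mulr_suml mean_sum.
rewrite -mulr_suml mean_sum; congr (_ * _); apply: eq_mean => x y _.
by rewrite sum_rate2.
Qed.

Lemma sum_fwd2_mid (f : X -> R) :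
  \sum_z \sum_e \sum_e' fwd2 z e e' * f (swap e z) =
  \sum_z mean z (fun x y =>
    fdist x z / t * (fdist z y / (1 - t))) * f z.
Proof.
rewrite exchange_big /=.
transitivity (\sum_e \sum_z mean z (fun x y =>
    rate t (flip e) z x * (fdist z y / (1 - t))) * f z).
  apply: eq_bigr => e _.
  rewrite [RHS](reindex_inj (swap_inj (e := e))); apply: eq_bigr => z _.
  rewrite -mulr_suml; congr (_ * _).
  under eq_bigr => e' _ do rewrite fwd2_mid.
  rewrite mean_sum; apply: eq_mean => x y _.
  by rewrite -mulr_sumr sum_rate.
rewrite exchange_big; apply: eq_bigr => z _.
rewrite -mulr_suml mean_sum; congr (_ * _); apply: eq_mean => x y _.
by rewrite -mulr_suml (sum_flip (fun e => rate t e z x)) sum_rate distC.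
Qed.

Lemma sum_fwd2_mid' (f : X -> R) :
  \sum_z \sum_e \sum_e' fwd2 z e e' * f (swap e' z) =
  \sum_z mean z (fun x y =>
    fdist x z / t * (fdist z y / (1 - t))) * f z.
Proof.
rewrite -sum_fwd2_mid; apply: eq_bigr => z _; rewrite exchange_big.
by apply: eq_bigr => e _; apply: eq_bigr => e' _; rewrite fwd2C.
Qed.

Lemma sum_fwd2_end (f : X -> R) :
  \sum_z \sum_e \sum_e' fwd2 z e e' * f (swap e' (swap e z)) =
  \sum_z mean z (fun x _ =>
    fdist x z * (fdist x z - 1) / t ^+ 2) * f z.
Proof.
transitivity (\sum_z \sum_e' \sum_e mean z (fun x _ =>
   rate t (flip e') z x * rate t (flip e) (swap (flip e') z) x) * f z).
  under [RHS]eq_bigr => z _ do rewrite exchange_big.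
  rewrite [LHS]exchange_big [RHS]exchange_big; apply: eq_bigr => e _.
  rewrite [LHS]exchange_big [RHS]exchange_big; apply: eq_bigr => e' _.
  have s_inj : injective (swap e' \o swap e : X -> X).
    by apply: inj_comp; exact: swap_inj.
  rewrite [RHS](reindex_inj s_inj); apply: eq_bigr => z _.
  by rewrite fwd2_end.
apply: eq_bigr => z _; under eq_bigr => e _ do rewrite -mulr_suml mean_sum.
rewrite -mulr_suml mean_sum; congr (_ * _); apply: eq_mean => x y _.
rewrite (sum_flip (fun e' => \sum_e rate t e' z x * rate t (flip e) (swap e' z) x)).
under eq_bigr => e' _.
  rewrite (sum_flip (fun e => rate t e' z x * rate t e (swap e' z) x)); over.
by rewrite sum_rate2 /fdist distC.
Qed.

(** Second derivative of [t^k (1-t)^l] divided by [t^k (1-t)^l], for [k = d(x,z)] and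
    [l = d(z,y)]. *)
Definition accel z x y : R :=
  fdist x z * (fdist x z - 1) / t ^+ 2
  - 2 * (fdist x z / t * (fdist z y / (1 - t)))
  + fdist z y * (fdist z y - 1) / (1 - t) ^+ 2.

(* second-order discrete integration by parts *)
Lemma sum_accel (f : X -> R) :
  \sum_z mean z (accel z) * f z =
  \sum_z \sum_e \sum_e' fwd2 z e e' *
    (f z - f (swap e z) - f (swap e' z) + f (swap e' (swap e z))).
Proof.
transitivity (\sum_z \sum_e \sum_e' fwd2 z e e' * f z
  - \sum_z \sum_e \sum_e' fwd2 z e e' * f (swap e z)
  - \sum_z \sum_e \sum_e' fwd2 z e e' * f (swap e' z)
  + \sum_z \sum_e \sum_e' fwd2 z e e' * f (swap e' (swap e z))).
  rewrite sum_fwd2_start sum_fwd2_mid sum_fwd2_mid' sum_fwd2_end.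
  rewrite -!sumrB -big_split; apply: eq_bigr => z _ /=.
  rewrite -!mulrBl -mulrDl !meanB meanD; congr (_ * _).
  by apply: eq_mean => x y _; rewrite /accel; ring.
rewrite -!sumrB -big_split; apply: eq_bigr => z _ /=.
rewrite -!sumrB -big_split; apply: eq_bigr => e _ /=.
rewrite -!sumrB -big_split; apply: eq_bigr => e' _ /=.
by ring.
Qed.

Lemma ln_mul_ge (q a : R) : 0 < q -> 0 < a -> q - a <= q * ln (q / a).
Proof.
move=> q0 a0; have qa : 0 < a / q by rewrite divr_gt0.
have : ln (a / q) <= a / q - 1.
  have {1}-> : a / q = 1 + (a / q - 1) by ring.
  by apply: le_ln1Dx; lra.
rewrite -[q / a]invrK invf_div lnV ?posrE // => le.
have -> : q - a = q * - (a / q - 1) by field; rewrite gt_eqF.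
by rewrite ler_pM2l // lerN2.
Qed.

Let Q := bridge pi t.

Definition distinct e e' : bool := (e.1 != e'.1) && (e.2 != e'.2).

(** Multiplying [fwd_bwd_fwd2] for the two paths around the square with corners [z, w, w', v] and
    flux [q] expresses [Q z Q v / (Q w Q w')] as the product of [q / a] for the two products [a] on
    the left. Hence [ln_mul_ge] applies twice; the constants [1] and [c] cancel in the alternating
    sum. *)
Lemma square_bound z e e' (v := swap e' (swap e z)) (c : R) :
  0 < c ->
  2 * fwd2 z e e' - (distinct e e')%:R * (fwd z e * fwd z e' / Q z)
  - (distinct e e')%:R * (bwd v e * bwd v e' / Q v) <=
  fwd2 z e e' * ((ln (Q z / c) + 1) - (ln (Q (swap e z) / c) + 1)
    - (ln (Q (swap e' z) / c) + 1) + (ln (Q v / c) + 1)).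
Proof.
move=> c0.
have Q0 u : 0 <= Q u by apply: bridge_ge0.
(* Without flux the right side is 0 whatever the logarithms are, and the left side is
   nonpositive. *)
have [q0|q0] := eqVneq (fwd2 z e e') 0.
  rewrite q0 mulr0 mul0r sub0r -opprD oppr_le0.
  by rewrite addr_ge0 // !mulr_ge0 ?fwd_ge0 ?bwd_ge0 ?invr_ge0.
have [vE d1 d2] := fwd2_neq0 q0.
rewrite /distinct d1 d2 !mul1r.
have Qz : 0 < Q z by apply: bridge_gt0 q0.
have Qw : 0 < Q (swap e z) by move: (q0); rewrite fwd2_mid => /bridge_gt0.
have Qw' : 0 < Q (swap e' z) by move: (q0); rewrite fwd2C fwd2_mid => /bridge_gt0.
have Qv : 0 < Q v by move: (q0); rewrite fwd2_end => /bridge_gt0.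
have E1 : fwd z e * bwd v e' = Q (swap e z) * fwd2 z e e' := fwd_bwd_fwd2 z e e'.
have E2 : fwd z e' * bwd v e = Q (swap e' z) * fwd2 z e e'.
  by rewrite /v vE fwd_bwd_fwd2 fwd2C.
have {q0}q0 : 0 < fwd2 z e e' by rewrite lt0r q0 fwd2_ge0.
have P1 : 0 < fwd z e * bwd v e' by rewrite E1 mulr_gt0.
have P2 : 0 < fwd z e' * bwd v e by rewrite E2 mulr_gt0.
have [f1 b1] : 0 < fwd z e /\ 0 < bwd v e'.
  by move: P1; rewrite !lt0r !mulf_eq0 negb_or !fwd_ge0 !bwd_ge0 !andbT => /andP[/andP[]].
have [f2 b2] : 0 < fwd z e' /\ 0 < bwd v e.
  by move: P2; rewrite !lt0r !mulf_eq0 negb_or !fwd_ge0 !bwd_ge0 !andbT => /andP[/andP[]].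
set q := fwd2 z e e' in q0 E1 E2 *.
have A : 0 < fwd z e * fwd z e' / Q z by rewrite divr_gt0 ?mulr_gt0.
have B : 0 < bwd v e * bwd v e' / Q v by rewrite divr_gt0 ?mulr_gt0.
have LA := ln_mul_ge q0 A; have LB := ln_mul_ge q0 B.
suff -> : ln (Q z / c) + 1 - (ln (Q (swap e z) / c) + 1)
    - (ln (Q (swap e' z) / c) + 1) + (ln (Q v / c) + 1) =
    ln (q / (fwd z e * fwd z e' / Q z)) + ln (q / (bwd v e * bwd v e' / Q v)).
  by rewrite mulrDr; lra.
have lnE a b : 0 < a -> 0 < b -> ln (a / b) = ln a - ln b :> R.
  by move=> a0 b0; rewrite lnM ?lnV ?posrE ?invr_gt0.
have lnE' a b : 0 < a -> 0 < b -> ln (a * b) = ln a + ln b :> R.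
  by move=> a0 b0; rewrite lnM.
rewrite (lnE q) // (lnE q) // !lnE ?mulr_gt0 // !lnE' //.
have := congr1 (@ln R) E1; have := congr1 (@ln R) E2.
by rewrite !lnE' //; lra.
Qed.

End Mean.

(** * Time derivatives and moments of the bridge between two points *)

Section BridgePolynomial.
Variables (R : realType) (n kappa : nat).
Local Notation X := (slice n kappa).
Implicit Types (x y z w : X) (t : R).

Definition drift t z x y : R := fdist R x z / t - fdist R z y / (1 - t).

(** As a polynomial in time the bridge can be differentiated formally and is continuous up to the
    times 0 and 1. *)
Definition bridge_xy_poly x y z : {poly R} :=
  ((between x y z)%:R / 'C(dist x y, dist x z)%:R) *:
  ('X ^+ dist x z * (1 - 'X) ^+ dist z y).

Lemma horner_bridge_xy x y z t : (bridge_xy_poly x y z).[t] = bridge_xy t x y z.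
Proof. by rewrite /bridge_xy_poly /bridge_xy !hornerE ?mulrA. Qed.

Let derivXnE k t : t != 0 -> ('X ^+ k : {poly R})^`().[t] = t ^+ k * (k%:R / t).
Proof.
move=> t0; rewrite derivXn hornerMn hornerXn.
by case: k => [|k]; rewrite ?mulr0n ?mul0r ?mulr0 // exprS -mulr_natr; field.
Qed.

Let derivXn2E k t : t != 0 ->
  ('X ^+ k : {poly R})^`()^`().[t] = t ^+ k * (k%:R * (k%:R - 1) / t ^+ 2).
Proof.
move=> t0; rewrite derivXn derivMn hornerMn derivXnE //.
case: k => [|k]; first by rewrite mulr0n !mul0r mulr0.
by rewrite /= exprS -mulr_natr -natr1; field.
Qed.

Let comp1X (p : {poly R}) t : (p \Po (1 - 'X)).[t] = p.[1 - t].
Proof. by rewrite horner_comp !hornerE. Qed.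

Let deriv1X : (1 - 'X : {poly R})^`() = - 1.
Proof. by rewrite derivB derivX -polyC1 derivC sub0r. Qed.

Let deriv1XnE k t : 1 - t != 0 ->
  ((1 - 'X) ^+ k : {poly R})^`().[t] = - ((1 - t) ^+ k * (k%:R / (1 - t))).
Proof.
move=> t1; rewrite -comp_Xn_poly deriv_comp deriv1X mulrN1 hornerN comp1X.
by rewrite derivXnE.
Qed.

Let deriv1Xn2E k t : 1 - t != 0 -> ((1 - 'X) ^+ k : {poly R})^`()^`().[t] =
  (1 - t) ^+ k * (k%:R * (k%:R - 1) / (1 - t) ^+ 2).
Proof.
move=> t1; rewrite -comp_Xn_poly deriv_comp deriv1X mulrN1 derivN deriv_comp.
by rewrite deriv1X mulrN1 opprK comp1X derivXn2E.
Qed.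

Let h1XnE k t : ((1 - 'X) ^+ k : {poly R}).[t] = (1 - t) ^+ k.
Proof. by rewrite horner_exp !hornerE. Qed.

Lemma deriv_bridge_xy x y z t : 0 < t < 1 ->
  (bridge_xy_poly x y z)^`().[t] = bridge_xy t x y z * drift t z x y.
Proof.
case/andP => t0 t1.
have t'0 : t != 0 by rewrite gt_eqF.
have t'1 : 1 - t != 0 by rewrite gt_eqF // subr_gt0.
rewrite /bridge_xy_poly derivZ derivM !(hornerZ, hornerD, hornerM).
by rewrite derivXnE // deriv1XnE // hornerXn h1XnE /bridge_xy /drift /fdist; ring.
Qed.

Lemma deriv2_bridge_xy x y z t : 0 < t < 1 ->
  (bridge_xy_poly x y z)^`()^`().[t] = bridge_xy t x y z * accel t z x y.
Proof.
case/andP => t0 t1.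
have t'0 : t != 0 by rewrite gt_eqF.
have t'1 : 1 - t != 0 by rewrite gt_eqF // subr_gt0.
rewrite /bridge_xy_poly derivZ derivZ derivM derivD !derivM.
rewrite !(hornerZ, hornerD, hornerM).
rewrite !derivXnE // !derivXn2E // !deriv1XnE // !deriv1Xn2E //.
by rewrite hornerXn h1XnE /bridge_xy /accel /fdist; ring.
Qed.

Lemma bridge_xy_start x y z : bridge_xy 0 x y z = (z == x)%:R :> R.
Proof.
have [->|zx] := eqVneq z x.
  rewrite /bridge_xy /between distxx add0n eqxx bin0 invr1 !mul1r.
  by rewrite subr0 expr1n.
rewrite /bridge_xy expr0n; have -> : (dist x z == 0%N) = false.
  by rewrite dist_eq0 eq_sym; apply/negbTE.
by rewrite mulr0 mul0r.
Qed.

Lemma bridge_xy_stop x y z : bridge_xy 1 x y z = (z == y)%:R :> R.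
Proof.
rewrite -(bridge_xy_start y x) -[in RHS]bridge_xy_rev.
by rewrite subr0.
Qed.

Lemma sum_bridge_xy_drift t x y : 0 < t < 1 ->
  \sum_z bridge_xy t x y z * drift t z x y = 0.
Proof.
move=> t01; under eq_bigr => z _ do rewrite mulrBr.
rewrite sumrB; apply/eqP; rewrite subr_eq0; apply/eqP/esym.
transitivity (\sum_z \sum_e bridge_xy t x y z * rate (1 - t) e z y).
  by apply: eq_bigr => z _; rewrite -mulr_sumr sum_rate.
transitivity (\sum_z \sum_e bridge_xy t x y z * rate t (flip e) z x).
  rewrite exchange_big [RHS]exchange_big; apply: eq_bigr => e _.
  rewrite [RHS](reindex_inj (swap_inj (e := e))); apply: eq_bigr => z _.
  exact: bridge_transfer.
apply: eq_bigr => z _; rewrite -mulr_sumr.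
by rewrite (sum_flip (fun e => rate t e z x)) sum_rate /fdist distC.
Qed.

(** The total mass has derivative 0 by detailed balance and equals 1 at time 0; this replaces a
    count of the points at each level of the interval. *)
Lemma sum_bridge_xy t x y : 0 < t < 1 -> \sum_z bridge_xy t x y z = 1.
Proof.
move=> t01; have /andP[t0 t1] := t01.
pose S := \sum_z bridge_xy_poly x y z.
have SE s : S.[s] = \sum_z bridge_xy s x y z.
  by rewrite horner_sum; apply: eq_bigr => z _; rewrite horner_bridge_xy.
have dS s : s \in `]0, t[ -> is_derive s 1 (horner S) S^`().[s].
  by move=> _; exact: is_derive_poly.
have [|c] := MVT t0 dS.
  by apply: continuous_subspaceT => s; exact: continuous_horner.
rewrite in_itv /= => /andP[c0 ct].
rewrite !SE (big_morph _ (@derivD R) (@deriv0 R)) horner_sum.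
have c01 : 0 < c < 1 by rewrite c0 (lt_trans ct).
under [X in _ = X * _]eq_bigr => z _ do rewrite deriv_bridge_xy //.
rewrite sum_bridge_xy_drift // mul0r => /eqP; rewrite subr_eq0 => /eqP.
move=> ->; rewrite (bigD1 x) //= bridge_xy_start eqxx big1 ?addr0 //.
by move=> z /negPf zx; rewrite bridge_xy_start zx.
Qed.

Lemma sum_bridge_xy_gain t x y i : 0 < t < 1 ->
  \sum_z bridge_xy t x y z * ((~~ val z i && val y i)%:R / (1 - t)) =
  \sum_z bridge_xy t x y z * ((val z i && ~~ val x i)%:R / t).
Proof.
move=> t01.
transitivity (\sum_z \sum_j bridge_xy t x y z * rate (1 - t) (i, j) z y).
  by apply: eq_bigr => z _; rewrite -mulr_sumr sum_rate_row.
transitivity (\sum_z \sum_j bridge_xy t x y z * rate t (j, i) z x).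
  rewrite exchange_big [RHS]exchange_big; apply: eq_bigr => j _.
  rewrite [RHS](reindex_inj (swap_inj (e := (i, j)))); apply: eq_bigr => z _.
  exact: bridge_transfer.
by apply: eq_bigr => z _; rewrite -mulr_sumr sum_rate_col.
Qed.

Lemma sum_bridge_xy_loss t x y i : 0 < t < 1 ->
  \sum_z bridge_xy t x y z * ((val z i && ~~ val y i)%:R / (1 - t)) =
  \sum_z bridge_xy t x y z * ((~~ val z i && val x i)%:R / t).
Proof.
move=> t01; have t01' : 0 < 1 - t < 1 by lra.
have := sum_bridge_xy_gain y x i t01'; rewrite subKr.
under eq_bigr => z _ do rewrite bridge_xy_rev.
by under [X in _ = X]eq_bigr => z _ do rewrite bridge_xy_rev.
Qed.

Lemma between_neq x y z i : between x y z ->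
  (val x i != val y i)%:R = (val z i != val x i)%:R + (val z i != val y i)%:R :> R.
Proof.
move/betweenP/(_ i); case: (val x i); case: (val y i); case: (val z i) => //= h;
by rewrite ?addr0 ?add0r //; have := h erefl.
Qed.

(** Let [A] and [B] be the masses where coordinate [i] has moved and has yet to move. Their sum is
    known, and detailed balance for moves involving [i] gives [B / (1 - t) = A / t]; this determines
    both. *)
Lemma sum_bridge_xy_moved t x y i : 0 < t < 1 ->
  \sum_z bridge_xy t x y z * (val z i != val x i)%:R =
    t * (val x i != val y i)%:R /\
  \sum_z bridge_xy t x y z * (val z i != val y i)%:R =
    (1 - t) * (val x i != val y i)%:R.
Proof.
move=> t01; have /andP[t0 t1] := t01.
set A := \sum_z _; set B := \sum_z _.
have AB : A + B = (val x i != val y i)%:R.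
  transitivity ((\sum_z bridge_xy t x y z) * (val x i != val y i)%:R).
    rewrite mulr_suml -big_split.
    apply: eq_bigr => z _ /=; rewrite -mulrDr.
    have [b|b] := boolP (between x y z); first by rewrite (between_neq i b).
    by rewrite bridge_xy0 // !mul0r.
  by rewrite sum_bridge_xy // mul1r.
have : B / (1 - t) = A / t.
  rewrite !mulr_suml.
  transitivity (\sum_z (bridge_xy t x y z * ((~~ val z i && val y i)%:R / (1 - t)) +
    bridge_xy t x y z * ((val z i && ~~ val y i)%:R / (1 - t)))).
    apply: eq_bigr => z _; rewrite -mulrDr -mulrDl -mulrA; congr (_ * (_ * _)).
    by case: (val z i); case: (val y i); rewrite /= ?addr0 ?add0r.
  rewrite big_split /= sum_bridge_xy_gain // sum_bridge_xy_loss // -big_split /=.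
  apply: eq_bigr => z _; rewrite -mulrDr -mulrDl -[RHS]mulrA; congr (_ * (_ * _)).
  by case: (val z i); case: (val x i); rewrite /= ?addr0 ?add0r.
rewrite -AB => BA; have t1' : 1 - t != 0 by rewrite gt_eqF // subr_gt0.
have t0' : t != 0 by rewrite gt_eqF.
have {BA}BA : B * t = A * (1 - t).
  have -> : B * t = B / (1 - t) * (1 - t) * t by field.
  by rewrite BA; field.
by split; lra.
Qed.

Lemma sum_bridge_xy_dist t x y : 0 < t < 1 ->
  \sum_z bridge_xy t x y z * (fdist R x z) = t * (fdist R x y) /\
  \sum_z bridge_xy t x y z * (fdist R z y) = (1 - t) * (fdist R x y).
Proof.
move=> t01; have dE u v : fdist R u v * 2 = \sum_i (val v i != val u i)%:R.
  rewrite /fdist -natrM muln2 double_dist natr_sum; apply: eq_bigr => i _.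
  by rewrite eq_sym.
split; apply: (@mulIf _ 2) => //.
- rewrite -[RHS]mulrA dE mulr_suml mulr_sumr.
  transitivity (\sum_z \sum_i bridge_xy t x y z * (val z i != val x i)%:R).
    by apply: eq_bigr => z _; rewrite -mulrA dE mulr_sumr.
  rewrite exchange_big; apply: eq_bigr => i _.
  by rewrite (sum_bridge_xy_moved x y i t01).1 eq_sym.
- rewrite -[RHS]mulrA dE mulr_suml mulr_sumr.
  transitivity (\sum_z \sum_i bridge_xy t x y z * (val z i != val y i)%:R).
    apply: eq_bigr => z _; rewrite -mulrA dE mulr_sumr; apply: eq_bigr => i _.
    by rewrite eq_sym.
  rewrite exchange_big; apply: eq_bigr => i _.
  by rewrite (sum_bridge_xy_moved x y i t01).2 eq_sym.
Qed.

End BridgePolynomial.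

(* The Cauchy-Schwarz inequality [a^2 / q >= 2 l a - l^2 q], linearised so
   that it can be summed without tracking vanishing weights. *)
Lemma sqr_div_ge (R : realFieldType) (a q l : R) :
  0 <= q -> (q = 0 -> a = 0) -> 2 * l * a - l ^+ 2 * q <= a ^+ 2 / q.
Proof.
rewrite le_eqVlt => /predU1P[<- /(_ erefl) ->|q0 _].
  by rewrite expr0n !mulr0 mul0r subr0.
rewrite ler_pdivlMr //; have := sqr_ge0 (a - l * q); rewrite sqrrB => h.
by rewrite -subr_ge0 (le_trans h) // le_eqVlt; apply/orP; left; apply/eqP; ring.
Qed.

Lemma sum_sqr_ge (R : realFieldType) (I : finType) (P : pred I) (f : I -> R) :
  (\sum_(i | P i) f i) ^+ 2 <= (#|P|)%:R * \sum_(i | P i) f i ^+ 2.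
Proof.
set s := \sum_(i | P i) f i; have [/card0_eq P0|P0] := posnP #|P|.
  rewrite /s big_pred0 // expr0n /= mulr_ge0 // sumr_ge0 // => i _.
  exact: sqr_ge0.
have P0' : 0 < #|P|%:R :> R by rewrite ltr0n.
have : \sum_(i | P i) (2 * (s / #|P|%:R) * f i - (s / #|P|%:R) ^+ 2) <=
       \sum_(i | P i) f i ^+ 2.
  apply: ler_sum => i _; have := sqr_ge0 (f i - s / #|P|%:R).
  by rewrite sqrrB; lra.
rewrite sumrB -mulr_sumr -/s sumr_const -mulr_natr.
rewrite -(ler_pM2l P0'); apply: le_trans; rewrite le_eqVlt.
by apply/orP; left; apply/eqP; field; rewrite gt_eqF.
Qed.

(** * Lower bounds for the second derivative of the entropy *)

Section Bounds.
Variables (R : realType) (n kappa : nat).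
Local Notation X := (slice n kappa).
Implicit Types (x y z w : X) (e : 'I_n * 'I_n).
Variables (pi : X -> X -> R) (t : R).
Hypothesis t01 : 0 < t < 1.
Hypothesis swpi : switching pi.

Let Q := bridge pi t.
Let M := mean pi t.
Let t_gt0 : 0 < t := time_gt0 t01.
Let t_lt1 : 0 < 1 - t := time_lt1 t01.

Let Q_ge0 z : 0 <= Q z. Proof. exact: bridge_ge0. Qed.

Lemma mean_indep_div z (F G : X -> R) :
  M z (fun x y => F x * G y) = M z (fun x _ => F x) * M z (fun _ y => G y) / Q z.
Proof.
rewrite /M mean_indep //; have [Q0|Q0] := eqVneq (Q z) 0.
  by rewrite !(mean_bridge0 t01 swpi) // mulr0 mul0r.
by rewrite -/Q mulrAC divff // mul1r.
Qed.

Lemma sum_fwd2 : \sum_z \sum_e \sum_e' fwd2 pi t z e e' =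
  \sum_z (\sum_e bwd pi t z e) * (\sum_e fwd pi t z e) / Q z.
Proof.
have := sum_fwd2_mid pi t01 (fun=> 1).
under eq_bigr => z _ do under eq_bigr => e _ do
  under eq_bigr => e' _ do rewrite mulr1.
move=> ->; apply: eq_bigr => z _; rewrite mulr1 sum_bwd sum_fwd.
exact: (mean_indep_div z (fun x => fdist R x z / t)
  (fun y => fdist R z y / (1 - t))).
Qed.

Lemma mean_drift z :
  M z (drift t z) = \sum_e bwd pi t z e - \sum_e fwd pi t z e.
Proof. by rewrite sum_bwd sum_fwd meanB. Qed.

Lemma entropy_accel_ge (c : R) : 0 < c ->
  \sum_z (\sum_e \sum_e' (~~ distinct e e')%:R *
     (fwd pi t z e * fwd pi t z e' + bwd pi t z e * bwd pi t z e')) / Q z <=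
  \sum_z (M z (accel t z) * (ln (Q z / c) + 1) + M z (drift t z) ^+ 2 / Q z).
Proof.
move=> c0; rewrite [leRHS]big_split /=.
rewrite /M sum_accel //.
set Z := \sum_z \sum_e \sum_e' _ * _.
pose D z (f : 'I_n * 'I_n -> R) :=
  \sum_e \sum_e' (distinct e e')%:R * (f e * f e' / Q z).
have Zge : 2 * (\sum_z \sum_e \sum_e' fwd2 pi t z e e')
    - \sum_z D z (fwd pi t z) - \sum_z D z (bwd pi t z) <= Z.
  (* Backward rates are attributed to the opposite corner of each square, where [square_bound] has
     them. *)
  have -> : \sum_z D z (bwd pi t z) = \sum_z \sum_e \sum_e'
      let v := swap e' (swap e z) in
      (distinct e e')%:R * (bwd pi t v e * bwd pi t v e' / Q v).
    rewrite /D exchange_big [RHS]exchange_big; apply: eq_bigr => e _.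
    rewrite exchange_big [RHS]exchange_big; apply: eq_bigr => e' _ /=.
    have s_inj : injective (swap e' \o swap e : X -> X).
      by apply: inj_comp; exact: swap_inj.
    by rewrite (reindex_inj s_inj).
  rewrite mulr_sumr -!sumrB; apply: ler_sum => z _.
  rewrite mulr_sumr -!sumrB; apply: ler_sum => e _.
  rewrite mulr_sumr -!sumrB; apply: ler_sum => e' _.
  exact: square_bound.
apply: le_trans (lerD Zge (lexx _)); rewrite sum_fwd2 mulr_sumr -!sumrB -big_split.
apply: ler_sum => z _ /=; rewrite -/(M z) mean_drift.
set F := fwd pi t z; set B := bwd pi t z.
have DE (f : 'I_n * 'I_n -> R) : D z f =
    (\sum_e f e) ^+ 2 / Q z - (\sum_e \sum_e' (~~ distinct e e')%:R * (f e * f e')) / Q z.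
  rewrite expr2 big_distrlr /= !mulr_suml -sumrB; apply: eq_bigr => e _.
  rewrite !mulr_suml -sumrB; apply: eq_bigr => e' _.
  by case: (distinct e e'); rewrite /=; ring.
(* Only the identity [2 B F - F^2 - B^2 + (B - F)^2 = 0] for the total fluxes is left, besides the
   pairs that are not distinct. *)
rewrite !DE le_eqVlt; apply/orP; left; apply/eqP.
have -> : \sum_e \sum_e' (~~ distinct e e')%:R * (F e * F e' + B e * B e') =
   \sum_e \sum_e' (~~ distinct e e')%:R * (F e * F e')
   + \sum_e \sum_e' (~~ distinct e e')%:R * (B e * B e').
  rewrite -big_split; apply: eq_bigr => e _ /=.
  by rewrite -big_split; apply: eq_bigr => e' _ /=; rewrite mulrDr.
ring.
Qed.

(* mass of the bridges through [z] that still have to change, respectively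
   have already changed, coordinate [i] *)
Definition frow z i : R := M z (fun _ y => (val z i != val y i)%:R / (1 - t)).
Definition brow z i : R := M z (fun x _ => (val z i != val x i)%:R / t).

Let row_sum (f : 'I_n * 'I_n -> R) : (forall e, 0 <= f e) ->
  \sum_i (\sum_j f (i, j)) ^+ 2 <=
  \sum_e \sum_e' (~~ distinct e e')%:R * (f e * f e').
Proof.
move=> f0.
rewrite [leRHS](_ : _ = \sum_i \sum_j \sum_i' \sum_j'
   (~~ distinct (i, j) (i', j'))%:R * (f (i, j) * f (i', j'))); last first.
  rewrite [RHS]pair_bigA /=; apply: eq_bigr => -[i j] _.
  by rewrite [RHS]pair_bigA /=; apply: eq_bigr => -[i' j'] _.
apply: ler_sum => i _; rewrite expr2 big_distrlr /=; apply: ler_sum => j _.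
rewrite [leRHS](bigD1 i) //= -[leLHS]addr0 lerD //.
  by apply: ler_sum => j' _; rewrite /distinct /= eqxx mul1r.
apply: sumr_ge0 => i' _; apply: sumr_ge0 => j' _.
by apply: mulr_ge0 => //; apply: mulr_ge0.
Qed.

Let col_sum (f : 'I_n * 'I_n -> R) : (forall e, 0 <= f e) ->
  \sum_j (\sum_i f (i, j)) ^+ 2 <=
  \sum_e \sum_e' (~~ distinct e e')%:R * (f e * f e').
Proof.
move=> f0; apply: le_trans (row_sum (f := f \o (@flip n)) _) _ => [e|].
  exact: f0.
rewrite le_eqVlt; apply/orP; left; apply/eqP.
rewrite [RHS](reindex_inj (inv_inj (@flipK n))); apply: eq_bigr => e _.
rewrite [RHS](reindex_inj (inv_inj (@flipK n))); apply: eq_bigr => e' _.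
by rewrite /distinct /= andbC.
Qed.

Let sqr_if (b : bool) (a : R) : (if b then a ^+ 2 else 0) = (b%:R * a) ^+ 2.
Proof. by case: b; rewrite ?mul1r // mul0r expr0n. Qed.

(** Forward moves lower the ones, which are column indices of the matrix of rates, and raise the
    zeros, which are row indices; backward moves exchange the roles. *)
Let fwd_flux z (a : bool) : \sum_(i | val z i == a) frow z i ^+ 2 <=
  \sum_e \sum_e' (~~ distinct e e')%:R * (fwd pi t z e * fwd pi t z e').
Proof.
have f0 e : 0 <= fwd pi t z e by apply: fwd_ge0.
rewrite big_mkcond; case: a.
  apply: le_trans (col_sum f0); rewrite le_eqVlt; apply/orP; left; apply/eqP.
  apply: eq_bigr => j _; rewrite sqr_if mean_sum mulrC meanZ; congr (_ ^+ 2).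
  apply: eq_mean => x y _; rewrite sum_rate_col.
  by case: (val z j); case: (val y j); rewrite /= ?mulr1 ?mulr0 ?mul0r.
apply: le_trans (row_sum f0); rewrite le_eqVlt; apply/orP; left; apply/eqP.
apply: eq_bigr => j _; rewrite sqr_if mean_sum mulrC meanZ; congr (_ ^+ 2).
apply: eq_mean => x y _; rewrite sum_rate_row.
by case: (val z j); case: (val y j); rewrite /= ?mulr1 ?mulr0 ?mul0r.
Qed.

Let bwd_flux z (a : bool) : \sum_(i | val z i == a) brow z i ^+ 2 <=
  \sum_e \sum_e' (~~ distinct e e')%:R * (bwd pi t z e * bwd pi t z e').
Proof.
have f0 e : 0 <= bwd pi t z e by apply: bwd_ge0.
rewrite big_mkcond; case: a.
  apply: le_trans (row_sum f0); rewrite le_eqVlt; apply/orP; left; apply/eqP.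
  apply: eq_bigr => j _; rewrite sqr_if mean_sum mulrC meanZ; congr (_ ^+ 2).
  apply: eq_mean => x y _; rewrite /flip /= sum_rate_col.
  by case: (val z j); case: (val x j); rewrite /= ?mulr1 ?mulr0 ?mul0r.
apply: le_trans (col_sum f0); rewrite le_eqVlt; apply/orP; left; apply/eqP.
apply: eq_bigr => j _; rewrite sqr_if mean_sum mulrC meanZ; congr (_ ^+ 2).
apply: eq_mean => x y _; rewrite /flip /= sum_rate_row.
by case: (val z j); case: (val x j); rewrite /= ?mulr1 ?mulr0 ?mul0r.
Qed.

(** The class of coordinates, ones or zeros, may be chosen at each point and in each direction; this
    freedom produces the minimum of [kappa] and [n - kappa] as well as the maxima in [Ttilde]. *)
Lemma entropy_accel_rows (c : R) (a b : X -> bool) : 0 < c ->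
  \sum_(z : X) (\sum_(i | val z i == a z) frow z i ^+ 2) / Q z
  + \sum_(z : X) (\sum_(i | val z i == b z) brow z i ^+ 2) / Q z <=
  \sum_z (M z (accel t z) * (ln (Q z / c) + 1) + M z (drift t z) ^+ 2 / Q z).
Proof.
move=> c0; apply: le_trans (entropy_accel_ge c0).
rewrite -big_split; apply: ler_sum => z _ /=; rewrite -mulrDl.
apply: ler_wpM2r; first by rewrite invr_ge0.
apply: le_trans (lerD (fwd_flux z (a z)) (bwd_flux z (b z))) _.
rewrite le_eqVlt; apply/orP; left; apply/eqP; rewrite -big_split.
apply: eq_bigr => e _ /=; rewrite -big_split; apply: eq_bigr => e' _ /=.
by rewrite mulrDr.
Qed.

(** Independence turns the product of means into a mean of products, and on a single geodesic a
    coordinate changes at most once. *)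
Lemma frow_brow z i : frow z i * brow z i = 0.
Proof.
rewrite mulrC mean_indep //.
rewrite (eq_mean pi t (G := fun _ _ => 0)) => [|x y /betweenP/(_ i)].
  by rewrite /mean big1 ?mulr0 // => p _; rewrite mulr0.
by case: (val x i); case: (val y i); case: (val z i) => //= h;
  rewrite ?(mulr0, mul0r) //; have := h erefl.
Qed.

Let Fz z := M z (fun _ y => fdist R z y / (1 - t)).
Let Bz z := M z (fun x _ => fdist R x z / t).

Let dist_part x y (a : bool) :
  fdist R x y = \sum_(i | val x i == a) (val x i != val y i)%:R.
Proof.
rewrite big_mkcond /fdist; case: a; rewrite ?dist_loss natr_sum.
  by apply: eq_bigr => i _; case: (val x i); case: (val y i).
rewrite -natr_sum -dist_loss dist_gain natr_sum.
by apply: eq_bigr => i _; case: (val x i); case: (val y i).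
Qed.

Lemma sum_frow z a : \sum_(i | val z i == a) frow z i = Fz z.
Proof.
rewrite /Fz /M /mean exchange_big; apply: eq_bigr => p _ /=.
by rewrite -mulr_sumr -mulr_suml -dist_part.
Qed.

Lemma sum_brow z a : \sum_(i | val z i == a) brow z i = Bz z.
Proof.
rewrite /Bz /M /mean exchange_big; apply: eq_bigr => p _ /=.
by rewrite -mulr_sumr -mulr_suml -dist_part /fdist distC.
Qed.

Lemma card_coord z (a : bool) :
  #|[pred i | val z i == a]| = if a then kappa else (n - kappa)%N.
Proof.
have c1 : #|[pred i | val z i == true]| = kappa.
  rewrite -sum1_card -[RHS](slice_sum z) big_mkcond; apply: eq_bigr => i _.
  by rewrite inE; case: (val z i).
case: a => //; rewrite -[n in RHS]card_ord -(cardC [pred i | val z i == true]).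
rewrite c1 addKn; apply: eq_card => i; rewrite !inE; by case: (val z i).
Qed.

(** Cauchy-Schwarz is applied to the sums [frow + brow], whose squares have no cross terms by
    [frow_brow]; bounding the two directions together gains a factor 2. *)
Lemma flux_ge z (a : bool) :
  (Fz z + Bz z) ^+ 2 <= (if a then kappa else (n - kappa)%N)%:R *
    (\sum_(i | val z i == a) frow z i ^+ 2 + \sum_(i | val z i == a) brow z i ^+ 2).
Proof.
rewrite -(card_coord z) -(sum_frow z a) -(sum_brow z a) -!big_split /=.
apply: le_trans (sum_sqr_ge _ _) _; rewrite ler_wpM2l // le_eqVlt.
apply/orP; left; apply/eqP; apply: eq_bigr => i _.
by rewrite sqrrD frow_brow mul0rn addr0.
Qed.

Let mass := \sum_(p : X * X) pi p.1 p.2.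
Let cost := \sum_(p : X * X) pi p.1 p.2 * fdist R p.1 p.2.

Lemma sum_bridge : \sum_z Q z = mass.
Proof.
transitivity (\sum_z M z (fun _ _ => 1)).
  by apply: eq_bigr => z _; rewrite /M mean1.
rewrite /M sum_mean; apply: eq_bigr => p _.
by rewrite -mulr_suml sum_bridge_xy // !mulr1.
Qed.

Lemma sum_flux : \sum_z (Fz z + Bz z) = 2 * cost.
Proof.
rewrite big_split /Fz /Bz /= /M !sum_mean -big_split mulr_sumr.
apply: eq_bigr => p _ /=.
have [d1 d2] := sum_bridge_xy_dist p.1 p.2 t01.
under eq_bigr => z _ do rewrite mulrA.
under [X in _ + _ * X]eq_bigr => z _ do rewrite mulrA.
rewrite -!mulr_suml d1 d2.
by field; rewrite !gt_eqF.
Qed.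

(** The total [A] equals the rescaled means of [k(k-1)], [l(l-1)] and [k l], since a flux can be
    read at any corner. Weighting with [t^2 + (1-t)^2 + 2 t (1-t) = 1] assembles [(k+l)(k+l-1)],
    where [k + l = d(x,y)]. *)
Lemma sum_mean_dist2 : \sum_z M z (fun x y => fdist R x z / t * (fdist R z y / (1 - t))) =
  \sum_(p : X * X) pi p.1 p.2 * (fdist R p.1 p.2 * (fdist R p.1 p.2 - 1)).
Proof.
have one (F : X -> R) : \sum_z F z = \sum_z F z * 1.
  by apply: eq_bigr => z _; rewrite mulr1.
set A := LHS.
have E1 : A = \sum_z M z (fun _ y => fdist R z y * (fdist R z y - 1)) / (1 - t) ^+ 2.
  under [RHS]eq_bigr => z _ do rewrite meanZ.
  by rewrite /A one -sum_fwd2_mid // [RHS]one -sum_fwd2_start.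
have E2 : A = \sum_z M z (fun x _ => fdist R x z * (fdist R x z - 1)) / t ^+ 2.
  under [RHS]eq_bigr => z _ do rewrite meanZ.
  by rewrite /A one -sum_fwd2_mid // [RHS]one -sum_fwd2_end.
have E3 : A = \sum_z M z (fun x y => fdist R x z * fdist R z y) / (t * (1 - t)).
  apply: eq_bigr => z _; rewrite meanZ; apply: eq_mean => x y _.
  by rewrite invfM; ring.
rewrite -!mulr_suml in E1 E2 E3.
have t0' : t != 0 by rewrite gt_eqF.
have t1' : 1 - t != 0 by rewrite gt_eqF.
pose S z x y := fdist R x y * (fdist R x y - 1).
transitivity (\sum_z M z (S z)); last first.
  rewrite /M sum_mean; apply: eq_bigr => p _; rewrite -mulr_suml sum_bridge_xy //.
  by rewrite mul1r.
transitivity (A * t ^+ 2 + A * (1 - t) ^+ 2 + 2 * (A * (t * (1 - t)))).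
  ring.
rewrite {1}E2 {1}E1 {1}E3 !divfK ?mulf_neq0 ?expf_neq0 //.
rewrite mulr_sumr -!big_split; apply: eq_bigr => z _ /=.
rewrite mulrC meanZ !meanD; apply: eq_mean => x y b.
by rewrite /S /fdist (between_dist b) natrD; ring.
Qed.

Lemma entropy_accel_flux (c : R) (m : nat) : 0 < c -> (0 < m)%N ->
  m = kappa \/ m = (n - kappa)%N ->
  m%:R^-1 * \sum_z (Fz z + Bz z) ^+ 2 / Q z <=
  \sum_z (M z (accel t z) * (ln (Q z / c) + 1) + M z (drift t z) ^+ 2 / Q z).
Proof.
move=> c0 m0 mk; pose a := m == kappa.
have m0' : 0 < m%:R :> R by rewrite ltr0n.
apply: le_trans (entropy_accel_rows (fun=> a) (fun=> a) c0).
rewrite mulr_sumr -big_split; apply: ler_sum => z _ /=.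
rewrite mulrA -mulrDl ler_wpM2r ?invr_ge0 // mulrC ler_pdivrMr // mulrC.
have -> : m = if a then kappa else (n - kappa)%N.
  by rewrite /a; case: eqP => //; case: mk.
exact: flux_ge.
Qed.

Lemma entropy_accel_cost (c : R) (m : nat) : 0 < c -> (0 < m)%N ->
  m = kappa \/ m = (n - kappa)%N -> mass = 1 ->
  4 / m%:R * cost ^+ 2 <=
  \sum_z (M z (accel t z) * (ln (Q z / c) + 1) + M z (drift t z) ^+ 2 / Q z).
Proof.
move=> c0 m0 mk mass1; apply: le_trans (entropy_accel_flux c0 m0 mk).
rewrite mulrAC mulrC ler_wpM2l ?invr_ge0 //.
(* The slope [2 * cost] is the total of [Fz + Bz], hence optimal for mass 1; its square accounts for
   the constant 4. *)
apply: (@le_trans _ _ (\sum_z (2 * (2 * cost) * (Fz z + Bz z) - (2 * cost) ^+ 2 * Q z))).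
  rewrite sumrB -!mulr_sumr sum_flux sum_bridge mass1; lra.
apply: ler_sum => z _; apply: sqr_div_ge => // Q0.
by rewrite /Fz /Bz /M !(mean_bridge0 t01 swpi) // addr0.
Qed.

(** Here [(F + B)^2 >= 4 F B] is used, because [F B / Q] is by independence a mean whose total over
    the slice does not depend on time. *)
Lemma entropy_accel_dist2 (c : R) (m : nat) : 0 < c -> (0 < m)%N ->
  m = kappa \/ m = (n - kappa)%N ->
  4 / m%:R * (\sum_(p : X * X) pi p.1 p.2 * (fdist R p.1 p.2 * (fdist R p.1 p.2 - 1))) <=
  \sum_z (M z (accel t z) * (ln (Q z / c) + 1) + M z (drift t z) ^+ 2 / Q z).
Proof.
move=> c0 m0 mk; apply: le_trans (entropy_accel_flux c0 m0 mk).
rewrite mulrAC mulrC ler_wpM2l ?invr_ge0 // -sum_mean_dist2 mulr_sumr.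
apply: ler_sum => z _.
rewrite (mean_indep_div z (fun x => fdist R x z / t) (fun y => fdist R z y / (1 - t))).
rewrite mulrA ler_wpM2r ?invr_ge0 // -/(Fz z) -/(Bz z).
have := sqr_ge0 (Fz z - Bz z); rewrite sqrrB sqrrD; lra.
Qed.

End Bounds.

(** * Flux bounds conditional on an end point *)

Section Kernel.
Variables (R : realType) (n kappa : nat).
Local Notation X := (slice n kappa).
Implicit Types (x y z w : X).
Variables (nu : X -> R) (pi : X -> X -> R).
Hypothesis pi_ge0 : forall x y, 0 <= pi x y.
Hypothesis pi_sum : forall x, \sum_y pi x y = nu x.

Lemma marginal_ge0 x : 0 <= nu x.
Proof. by rewrite -pi_sum sumr_ge0. Qed.

Lemma kernel_mul i x :
  nu x * Pi_fwd nu pi i x = \sum_y pi x y * (val x i != val y i)%:R.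
Proof.
rewrite mulr_sumr; apply: eq_bigr => y _; rewrite /kernel_fwd.
(* Where [nu x] vanishes, so does the whole row of [pi]. *)
have [x0|x0] := eqVneq (nu x) 0; last by rewrite (eq_sym (val x i)); field.
have : \sum_y pi x y == 0 by rewrite pi_sum x0.
rewrite psumr_eq0 // => /allP/(_ y (mem_index_enum y)) /eqP ->.
by rewrite x0 !mul0r.
Qed.

Lemma Pi_fwd_ge0 i x : 0 <= Pi_fwd nu pi i x.
Proof.
apply: sumr_ge0 => y _; rewrite mulr_ge0 // divr_ge0 //; exact: marginal_ge0.
Qed.

Lemma Pi_fwd_le1 i x : Pi_fwd nu pi i x <= 1.
Proof.
have [x0|x0] := eqVneq (nu x) 0.
  rewrite /Pi_fwd big1 // => y _.
  by rewrite /kernel_fwd x0 invr0 !mulr0.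
have xgt0 : 0 < nu x by rewrite lt0r x0 marginal_ge0.
rewrite -(ler_pM2l xgt0) kernel_mul mulr1 -pi_sum; apply: ler_sum => y _.
by case: eqP; rewrite ?mulr0 ?mulr1.
Qed.

Lemma kernel_den_gt0 i x t : 0 < t < 1 -> 0 < 1 - t * Pi_fwd nu pi i x.
Proof.
case/andP => t0 t1; have p0 := Pi_fwd_ge0 i x; have p1 := Pi_fwd_le1 i x.
by rewrite subr_gt0 (le_lt_trans _ t1) // ler_piMr // ltW.
Qed.

Section Flux.
Variable t : R.
Hypothesis t01 : 0 < t < 1.
Hypothesis swpi : switching pi.

Let Q := bridge pi t.
Let M := mean pi t.
(** Joint law of the starting point and the position at time [t]. *)
Let V x z := M z (fun x' _ => (x' == x)%:R).

Let V_ge0 x z : 0 <= V x z. Proof. exact: mean_ge0. Qed.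

Let sumV z : \sum_x V x z = Q z.
Proof.
rewrite mean_sum /Q -mean1; apply: eq_mean => x y _.
by rewrite (bigD1 x) //= eqxx big1 ?addr0 // => x' /negPf; rewrite eq_sym => ->.
Qed.

Let ind_sum (F : X -> X -> R) x :
  \sum_(p : X * X) pi p.1 p.2 * ((p.1 == x)%:R * F p.1 p.2) =
  \sum_y pi x y * F x y.
Proof.
rewrite (eq_bigr (fun p => (fun x' y => pi x' y * ((x' == x)%:R * F x' y)) p.1 p.2)) //.
rewrite -(pair_bigA _ (fun x' y => pi x' y * ((x' == x)%:R * F x' y))) /=.
rewrite (bigD1 x) //= [X in _ + X]big1 ?addr0.
  by apply: eq_bigr => y _; rewrite eqxx mul1r.
by move=> x' /negPf ->; rewrite big1 // => y _; rewrite mul0r mulr0.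
Qed.

Let V_stay x i : \sum_z V x z * (val z i == val x i)%:R =
  nu x * (1 - t * Pi_fwd nu pi i x).
Proof.
transitivity (\sum_z M z (fun x' y => (x' == x)%:R * (val z i == val x' i)%:R)).
  apply: eq_bigr => z _; rewrite /V meanZ; apply: eq_mean => x' y _.
  by case: (eqVneq x' x) => [->|_]; rewrite ?mul0r.
rewrite sum_mean mulrBr mulr1 mulrCA kernel_mul -pi_sum mulr_sumr -sumrB.
rewrite (eq_bigr (fun p : X * X => pi p.1 p.2 * ((p.1 == x)%:R
   * (1 - t * (val p.1 i != val p.2 i)%:R)))); last first.
  move=> [x' y] _ /=; congr (_ * _).
  have <- : \sum_z bridge_xy t x' y z
      - \sum_z bridge_xy t x' y z * (val z i != val x' i)%:R =
      1 - t * (val x' i != val y i)%:R.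
    by rewrite sum_bridge_xy // (sum_bridge_xy_moved x' y i t01).1.
  rewrite -sumrB mulr_sumr; apply: eq_bigr => z _.
  by case: (val z i == val x' i); rewrite /=; ring.
rewrite (ind_sum (fun x' y => 1 - t * (val x' i != val y i)%:R)).
by apply: eq_bigr => y _; ring.
Qed.

(** Given [z], the future does not depend on the start, so [frow / Q] is also the rate seen from
    [x]. A coordinate yet to change at [z] still has its initial value; this has mean [(1 - t) Pi],
    and [1 - t] cancels. *)
Let V_row x i : \sum_z V x z * (val z i == val x i)%:R * (frow pi t z i / Q z) =
  nu x * Pi_fwd nu pi i x.
Proof.
transitivity (\sum_z M z (fun x' y => (x' == x)%:R *
   ((val z i != val y i)%:R / (1 - t)))).
  apply: eq_bigr => z _.
  transitivity (V x z * frow pi t z i / Q z * (val z i == val x i)%:R); first by ring.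
  have -> : V x z * frow pi t z i / Q z = M z (fun x' y => (x' == x)%:R *
     ((val z i != val y i)%:R / (1 - t))).
    by have := mean_indep_div t01 swpi z (fun x' => (x' == x)%:R)
         (fun y => (val z i != val y i)%:R / (1 - t)).
  rewrite meanZ; apply: eq_mean => x' y /betweenP/(_ i).
  case: (eqVneq x' x) => [->|_]; last by rewrite !mul0r.
  by case: (val x i); case: (val y i); case: (val z i) => //= h;
    rewrite ?(mulr0, mul0r, mulr1) //; have := h erefl.
rewrite sum_mean kernel_mul.
rewrite (eq_bigr (fun p : X * X => pi p.1 p.2 * ((p.1 == x)%:R
   * (val p.1 i != val p.2 i)%:R))); last first.
  move=> [x' y] _ /=; congr (_ * _).
  have <- : (1 - t) * (val x' i != val y i)%:R / (1 - t) = (val x' i != val y i)%:R.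
    by field; rewrite gt_eqF // time_lt1.
  rewrite -(sum_bridge_xy_moved x' y i t01).2 !mulr_suml mulr_sumr.
  by apply: eq_bigr => z _; ring.
exact: (ind_sum (fun x' y => (val x' i != val y i)%:R)).
Qed.

(* Conditionally on the starting point [x], coordinate [i] has not moved by
   time [t] with probability [1 - t Pi^i(x)]; Cauchy-Schwarz with this weight. *)
Lemma kernel_flux_le (a b : X -> bool) :
  (forall (z : X) a', \sum_(i | val z i == a') frow pi t z i ^+ 2 <=
                \sum_(i | val z i == b z) frow pi t z i ^+ 2) ->
  \sum_(x : X) nu x * \sum_(i | val x i == a x)
     Pi_fwd nu pi i x ^+ 2 / (1 - t * Pi_fwd nu pi i x) <=
  \sum_(z : X) (\sum_(i | val z i == b z) frow pi t z i ^+ 2) / Q z.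
Proof.
move=> bmax.
pose r z i := frow pi t z i / Q z.
apply: (@le_trans _ _ (\sum_x \sum_(z : X) V x z * \sum_(i | val z i == b z) r z i ^+ 2)).
  apply: ler_sum => x _.
  apply: (@le_trans _ _ (\sum_z \sum_(i | val x i == a x)
      V x z * (val z i == val x i)%:R * r z i ^+ 2)); last first.
    apply: ler_sum => z _.
    (* Where [z] and [x] agree, the class chosen at [x] consists of coordinates of one class at [z];
       [bmax] then passes to a class that depends on [z] alone, so that [x] can be summed out. *)
    apply: (@le_trans _ _ (V x z * \sum_(i | val z i == a x) r z i ^+ 2)).
      rewrite mulr_sumr [leLHS]big_mkcond [leRHS]big_mkcond; apply: ler_sum => i _.
      case: eqP => [<-|_]; first by case: eqP => _; rewrite ?mulr1 ?mulr0 ?mul0r.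
      by case: eqP => // _; rewrite mulr_ge0 // sqr_ge0.
    rewrite ler_wpM2l //.
    under eq_bigr => i _ do rewrite expr_div_n.
    under [leRHS]eq_bigr => i _ do rewrite expr_div_n.
    by rewrite -!mulr_suml ler_wpM2r // invr_ge0 sqr_ge0.
  rewrite exchange_big mulr_sumr; apply: ler_sum => i _.
  have den := kernel_den_gt0 i x t01.
  set P := Pi_fwd nu pi i x in den *.
  (* The optimal slope: the ratio of the sums in [V_row] and [V_stay]. *)
  pose l := P / (1 - t * P).
  apply: (@le_trans _ _ (\sum_z (2 * l * (V x z * (val z i == val x i)%:R * r z i)
     - l ^+ 2 * (V x z * (val z i == val x i)%:R)))).
    rewrite sumrB -!mulr_sumr V_row V_stay -/P /l le_eqVlt.
    by apply/orP; left; apply/eqP; field; rewrite gt_eqF.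
  apply: ler_sum => z _.
  have w0 : 0 <= V x z * (val z i == val x i)%:R by rewrite mulr_ge0.
  have := mulr_ge0 w0 (sqr_ge0 (r z i - l)); rewrite sqrrB; lra.
rewrite exchange_big; apply: ler_sum => z _ /=.
rewrite -mulr_suml sumV.
under eq_bigr => i _ do rewrite expr_div_n.
rewrite -mulr_suml; have [->|Q0] := eqVneq (Q z) 0; first by rewrite mul0r invr0 mulr0.
by rewrite le_eqVlt; apply/orP; left; apply/eqP; field.
Qed.

End Flux.
End Kernel.

(** * Time reversal *)

Section Reverse.
Variables (R : realType) (n kappa : nat).
Local Notation X := (slice n kappa).
Variables (pi : X -> X -> R) (t : R).

Lemma mean_rev z F :
  mean (fun x y => pi y x) (1 - t) z F = mean pi t z (fun x y => F y x).
Proof.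
have sK : involutive (fun p : X * X => (p.2, p.1)) by case.
rewrite /mean (reindex_inj (inv_inj sK)); apply: eq_bigr => -[x y] _ /=.
by rewrite bridge_xy_rev.
Qed.

Lemma bridge_rev z : bridge (fun x y => pi y x) (1 - t) z = bridge pi t z.
Proof. by rewrite -!mean1 mean_rev. Qed.

Lemma frow_rev z i : frow (fun x y => pi y x) (1 - t) z i = brow pi t z i.
Proof. by rewrite /frow mean_rev subKr. Qed.

End Reverse.

(** * The second derivative bound in terms of both kernels *)

Section EntropyAccelKernel.
Variables (R : realType) (n kappa : nat).
Local Notation X := (slice n kappa).
Variables (pi : X -> X -> R) (nu0 nu1 : X -> R) (t : R).
Hypothesis t01 : 0 < t < 1.
Hypothesis swpi : switching pi.
Hypothesis pi_fst : forall x, \sum_y pi x y = nu0 x.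
Hypothesis pi_snd : forall y, \sum_x pi x y = nu1 y.

Lemma entropy_accel_kernel (c : R) (a b : X -> bool) : 0 < c ->
  \sum_(x : X) nu0 x * \sum_(i | val x i == a x)
     Pi_fwd nu0 pi i x ^+ 2 / (1 - t * Pi_fwd nu0 pi i x)
  + \sum_(y : X) nu1 y * \sum_(i | val y i == b y)
     Pi_bwd nu1 pi i y ^+ 2 / (1 - (1 - t) * Pi_bwd nu1 pi i y) <=
  \sum_z (mean pi t z (accel t z) * (ln (bridge pi t z / c) + 1)
          + mean pi t z (drift t z) ^+ 2 / bridge pi t z).
Proof.
move=> c0.
have best (G : X -> bool -> R) : exists b : X -> bool, forall z a, G z a <= G z (b z).
  exists (fun z => G z false <= G z true) => z; case: (leP (G z false)) => h [] //.
  exact: ltW.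
have [a' amax] := best (fun (z : X) a => \sum_(i | val z i == a) frow pi t z i ^+ 2).
have [b' bmax] := best (fun (z : X) a => \sum_(i | val z i == a) brow pi t z i ^+ 2).
have [pi0 _ _] := swpi.
apply: le_trans (entropy_accel_rows t01 swpi a' b' c0).
have t01' : 0 < 1 - t < 1.
  by have /andP[t0 t1] := t01; apply/andP; split; lra.
apply: lerD; first exact: kernel_flux_le.
have rowE (z : X) a'' : \sum_(i | val z i == a'') brow pi t z i ^+ 2 =
    \sum_(i | val z i == a'') frow (fun x y => pi y x) (1 - t) z i ^+ 2.
  by apply: eq_bigr => i _; rewrite frow_rev.
have -> : \sum_(z : X) (\sum_(i | val z i == b' z) brow pi t z i ^+ 2) / bridge pi t z =
    \sum_(z : X) (\sum_(i | val z i == b' z) frow (fun x y => pi y x) (1 - t) z i ^+ 2)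
      / bridge (fun x y => pi y x) (1 - t) z.
  by apply: eq_bigr => z _; rewrite rowE bridge_rev.
(* The backward half is the forward bound for the transposed coupling at time [1 - t]. *)
apply: (@kernel_flux_le _ _ _ nu1 (fun x y => pi y x) (fun x y => pi0 y x) pi_snd
  (1 - t) t01' (switching_tr swpi) b b').
by move=> z a''; rewrite -!rowE.
Qed.

End EntropyAccelKernel.

(** * Powers of the generator and counting of geodesics *)

Section Heat.
Variables (R : realType) (n kappa : nat).
Local Notation X := (slice n kappa).
Implicit Types (x y z w : X) (e : 'I_n * 'I_n).

Lemma edge_dist z w : edge z w = (dist z w == 1)%N.
Proof.
apply/idP/eqP => [/exists_inP[i zi /exists_inP[j zj /eqP wE]]|zw].
  rewrite !inE in zi zj.
  have ij : i != j by apply: contraNneq zi => ->.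
  have wi : val w i by rewrite wE ffunE eqxx.
  have wj : ~~ val w j by rewrite wE ffunE eqxx eq_sym (negPf ij).
  have zw : toward (i, j) z w by apply/and4P.
  have [s1 s2 sk] := toward_swap zw.
  rewrite (toward_dist zw) (_ : swap _ _ = w) ?distxx //.
  apply: slice_ext => k; have [->|ki] := eqVneq k i; first by rewrite s1 wi.
  have [->|kj] := eqVneq k j; first by rewrite (negPf s2) (negPf wj).
  by rewrite sk // wE ffunE (negPf ki) (negPf kj).
have [i zi] : exists i, ~~ val z i && val w i.
  apply/existsP; rewrite -[[exists _, _]]negbK negb_exists; apply/negP => /forallP H.
  by move: zw; rewrite dist_gain big1 // => k _; rewrite (negPf (H k)).
have [j zj] : exists j, val z j && ~~ val w j.
  apply/existsP; rewrite -[[exists _, _]]negbK negb_exists; apply/negP => /forallP H.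
  by move: zw; rewrite dist_loss big1 // => k _; rewrite (negPf (H k)).
have /andP[zi1 zi2] := zi; have /andP[zj1 zj2] := zj.
have tzw : toward (i, j) z w by apply/and4P.
move: zw; rewrite (toward_dist tzw) => -[] /eqP; rewrite dist_eq0 => /eqP wE.
apply/exists_inP; exists i; first by rewrite inE.
apply/exists_inP; exists j; first by rewrite inE.
apply/eqP/ffunP => k; rewrite /sigma ffunE -wE.
have [s1 s2 sk] := toward_swap tzw.
have [->|ki] := eqVneq k i; first by rewrite s1.
by have [->|kj] := eqVneq k j; [apply/negbTE | rewrite sk].
Qed.

Lemma gen_sym z w : gen z w = gen w z :> R.
Proof. by rewrite /gen !edge_dist distC eq_sym. Qed.

Lemma card_toward x y : (\sum_e toward e x y)%N = (dist x y ^ 2)%N.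
Proof.
rewrite expnS expn1 {1}dist_gain dist_loss big_distrlr /= pair_bigA /=.
apply: eq_bigr => -[i j] _; rewrite mulnb /toward /=.
by case: (val x i); case: (val y i); case: (val x j); case: (val y j).
Qed.

(** First steps of geodesics are the moves [toward], each given by one of [d] gains and one of [d]
    losses. *)
Lemma card_geodesic_step x y k : dist x y = k.+1 ->
  #|[set w : X | (dist x w == 1%N) && (dist w y == k)]| = (k.+1 ^ 2)%N.
Proof.
move=> xy; rewrite -xy -card_toward.
have -> : [set w : X | (dist x w == 1%N) && (dist w y == k)] =
    (fun e => swap e x) @: [set e | toward e x y].
  apply/setP => w; rewrite inE; apply/idP/imsetP => [/andP[/eqP xw /eqP wy]|[e]].
    have bw : between x y w by rewrite /between xy xw wy add1n.
    have : (0 < \sum_e toward e x w)%N by rewrite card_toward xw.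
    rewrite lt0n sum_nat_eq0 negb_forall => /existsP[e]; rewrite /= eqb0 negbK => xwe.
    have wE : swap e x = w.
      by move: xw; rewrite (toward_dist xwe) => -[] /eqP; rewrite dist_eq0 => /eqP.
    exists e => //; rewrite inE /toward.
    have /and4P[h1 h2 h3 h4] := xwe.
    have H := betweenP _ _ _ bw; apply/and4P; split => //.
      case y1: (val y e.1) => //; have := H e.1.
      by rewrite y1 h2 (negPf h1) => /(_ erefl).
    case y2: (val y e.2) => //; have := H e.2.
    by rewrite y2 h3 (negPf h4) => /(_ erefl).
  rewrite inE => exy ->; move: xy; rewrite (toward_dist exy) => -[->].
  rewrite eqxx andbT; have exw : toward e x (swap e x).
    have [s1 s2 _] := toward_swap exy; have /and4P[h1 h2 h3 h4] := exy.
    by apply/and4P.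
  by rewrite (toward_dist exw) distxx.
rewrite card_in_imset => [|e e'].
  by rewrite -sum1_card big_mkcond; apply: eq_bigr => e _; rewrite inE; case: ifP.
rewrite !inE => h h' E.
have [s1 s2 sk] := toward_swap h; have [s1' s2' sk'] := toward_swap h'.
have /and4P[h1 h2 h3 h4] := h; have /and4P[h1' h2' h3' h4'] := h'.
have E1 : e.1 = e'.1.
  apply/eqP; apply: contraT => ne; move: s1; rewrite E sk' ?(negPf h1) //.
  by apply: contraNneq h1 => ->.
have E2 : e.2 = e'.2.
  apply/eqP; apply: contraT => ne; move: s2; rewrite E sk' ?h3 //.
  by apply: contraTneq h3 => ->.
by case: e e' E1 E2 {h h' E s1 s2 sk s1' s2' sk' h1 h2 h3 h4 h1' h2' h3' h4'}
  => ? ? [? ?] /= -> ->.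
Qed.

Local Notation G := (\matrix_(a < #|{: X}|, b < #|{: X}|)
  (gen (enum_val a) (enum_val b) : R)).

Definition gen_pow k x y : R := (G ^+ k) (enum_rank x) (enum_rank y).

Lemma gen_pow0 x y : gen_pow 0 x y = (x == y)%:R.
Proof. by rewrite /gen_pow expr0 mxE (inj_eq enum_rank_inj). Qed.

Let sum_rank (F : 'I_#|{: X}| -> R) : \sum_a F a = \sum_x F (enum_rank x).
Proof.
rewrite (reindex (@enum_rank X)) //=.
by exists enum_val => a _; rewrite ?enum_rankK ?enum_valK.
Qed.

Lemma gen_powS k x y : gen_pow k.+1 x y = \sum_w gen x w * gen_pow k w y.
Proof.
rewrite /gen_pow exprS -mulmxE mxE sum_rank; apply: eq_bigr => w _.
by rewrite mxE !enum_rankK.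
Qed.

Lemma gen_powSr k x y : gen_pow k.+1 x y = \sum_w gen_pow k x w * gen w y.
Proof.
rewrite /gen_pow exprSr -mulmxE mxE sum_rank; apply: eq_bigr => w _.
by congr (_ * _); rewrite mxE !enum_rankK.
Qed.

Lemma gen_pow_sym k x y : gen_pow k x y = gen_pow k y x.
Proof.
elim: k x y => [|k IH] x y; first by rewrite !gen_pow0 eq_sym.
by rewrite gen_powS gen_powSr; apply: eq_bigr => w _; rewrite IH gen_sym mulrC.
Qed.

(* The number of geodesics between points at distance [k] is [(k!)^2]. *)
Lemma gen_pow_geodesic k x y : (k <= dist x y)%N ->
  gen_pow k x y = if dist x y == k then (k`! ^ 2)%:R else 0.
Proof.
elim: k x y => [|k IH] x y kd.
  by rewrite gen_pow0 dist_eq0; case: eqP.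
rewrite gen_powS.
have term w : gen x w * gen_pow k w y =
    ((dist x w == 1%N) && (dist w y == k))%:R * (k`! ^ 2)%:R.
  have [->|xw] := eqVneq w x.
    by rewrite IH ?(ltnW kd) // gtn_eqF // mulr0 distxx mul0r.
  rewrite /gen eq_sym (negPf xw) edge_dist; case: eqP => xw1; last by rewrite !mul0r.
  rewrite IH; last by have := dist_triangle x y w; rewrite xw1; lia.
  by case: eqP; rewrite ?mulr0 ?mul0r ?mul1r.
rewrite (eq_bigr _ (fun w _ => term w)) -mulr_suml.
have [xy|xy] := eqVneq (dist x y) k.+1.
  rewrite -natr_sum (_ : (\sum_w _)%N = k.+1 ^ 2)%N ?factS ?expnMn ?natrM //.
  rewrite -(card_geodesic_step xy) -sum1_card [RHS]big_mkcond.
  by apply: eq_bigr => w _; rewrite inE; case: ifP.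
rewrite big1 ?mul0r // => w _; case: eqP => // xw; case: eqP => // wy.
by have := dist_triangle x y w; lia.
Qed.

End Heat.

Local Open Scope classical_set_scope.
Local Open Scope ring_scope.

(** * Small-time asymptotics of the heat kernel *)

Section HeatSeries.
Variables (R : realType) (n kappa : nat).
Local Notation X := (slice n kappa).
Implicit Types (x y z w : X).

Let M : R := \sum_x \sum_w `|gen (x : X) w|.

Let M_ge0 : 0 <= M.
Proof. by apply: sumr_ge0 => x _; apply: sumr_ge0. Qed.

Lemma gen_pow_le k x y : `|gen_pow R k x y| <= M ^+ k.
Proof.
elim: k x y => [|k IH] x y.
  by rewrite gen_pow0 expr0 ger0_norm // lern1 leq_b1.
rewrite gen_powS; apply: le_trans (ler_norm_sum _ _ _) _.
apply: (@le_trans _ _ (\sum_w `|gen x w| * M ^+ k)).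
  by apply: ler_sum => w _; rewrite normrM ler_wpM2l.
rewrite -mulr_suml exprS ler_wpM2r ?exprn_ge0 // /M [leRHS](bigD1 x) //= lerDl.
by apply: sumr_ge0 => x' _; apply: sumr_ge0.
Qed.

Definition heat_coeff (gamma : R) x y : R ^nat :=
  fun k => gamma ^+ k * gen_pow R k x y / k`!%:R.

Lemma heatE gamma x y : heat gamma 1 x y = limn (series (heat_coeff gamma x y)).
Proof.
rewrite /heat /expmx mxE mulr1; congr (limn (series _)); apply/funext => k.
rewrite /heat_coeff /gen_pow; congr (_ / _); set G := \matrix_(_, _) _.
suff -> : (gamma *: G) ^+ k = gamma ^+ k *: G ^+ k by rewrite mxE.
elim: k => [|k IH]; first by rewrite !expr0 scale1r.
by rewrite !exprS IH -!mulmxE -scalemxAl -scalemxAr scalerA.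
Qed.

Let heat_coeff_le gamma x y k : 0 <= gamma ->
  `|heat_coeff gamma x y k| <= exp_coeff (gamma * M) k.
Proof.
move=> g0; rewrite /heat_coeff /exp_coeff /= exprMn !normrM.
rewrite (ger0_norm (exprn_ge0 _ g0)) (@ger0_norm _ k`!%:R^-1) ?invr_ge0 //.
by rewrite ler_wpM2r ?invr_ge0 // ler_wpM2l ?exprn_ge0 // gen_pow_le.
Qed.

Lemma is_cvg_heat gamma x y : 0 <= gamma -> cvgn (series (heat_coeff gamma x y)).
Proof.
move=> g0; apply: normed_cvg.
apply: (series_le_cvg _ _ (fun k => heat_coeff_le x y k g0)) => //.
  by move=> k; rewrite exp_coeff_ge0 // mulr_ge0.
exact: is_cvg_series_exp_coeff.
Qed.

Lemma heat_sym gamma x y : heat gamma 1 x y = heat gamma 1 y x :> R.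
Proof.
rewrite !heatE; congr (limn (series _)); apply/funext => k.
by rewrite /heat_coeff gen_pow_sym.
Qed.

(** Terms of order below [d] vanish, the term of order [d] is [gamma^d (d!)^2 / d!], and the tail is
    [gamma^(d+1)] times at most the exponential series of [M]. *)
Let heat_partial gamma x y N (d := dist x y) : 0 < gamma <= 1 -> (d < N)%N ->
  `|series (heat_coeff gamma x y) N - gamma ^+ d * d`!%:R| <=
  gamma ^+ d.+1 * expR M.
Proof.
case/andP => g0 g1 dN.
have -> : series (heat_coeff gamma x y) N - gamma ^+ d * d`!%:R =
    \sum_(d.+1 <= k < N) heat_coeff gamma x y k.
  rewrite /series /= (@big_cat_nat _ _ _ d.+1) //= big_nat_recr //= big_nat_cond.
  rewrite big1 ?add0r => [|k /andP[/andP[_ kd] _]]; last first.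
    rewrite /heat_coeff gen_pow_geodesic; last by rewrite ltnW.
    by rewrite gtn_eqF // mulr0 mul0r.
  rewrite /heat_coeff gen_pow_geodesic // eqxx -/d natrX.
  have f0 : d`!%:R != 0 :> R by rewrite pnatr_eq0 -lt0n fact_gt0.
  by field.
apply: le_trans (ler_norm_sum _ _ _) _.
apply: (@le_trans _ _ (\sum_(d.+1 <= k < N) gamma ^+ d.+1 * exp_coeff M k)).
  rewrite [leLHS]big_nat_cond [leRHS]big_nat_cond; apply: ler_sum => k /andP[/andP[dk _] _].
  apply: le_trans (heat_coeff_le x y k (ltW g0)) _.
  rewrite /exp_coeff /= exprMn -mulrA ler_wpM2r //.
    by rewrite divr_ge0 // exprn_ge0.
  by rewrite -(subnK dk) exprD ler_piMl ?exprn_ge0 ?exprn_ile1 ?(ltW g0).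
rewrite -mulr_sumr; apply: ler_wpM2l; first by rewrite exprn_ge0 // ltW.
apply: (@le_trans _ _ (series (exp_coeff M) N)).
  rewrite /series /= [leRHS](@big_cat_nat _ _ _ d.+1) //= lerDr.
  by apply: sumr_ge0 => k _; rewrite exp_coeff_ge0.
apply: nondecreasing_cvgn_le; last exact: is_cvg_series_exp_coeff.
by apply: nondecreasing_series => k _ _; rewrite exp_coeff_ge0.
Qed.

Lemma heat_asymp gamma x y (d := dist x y) : 0 < gamma <= 1 ->
  `|heat gamma 1 x y - gamma ^+ d * d`!%:R| <= gamma ^+ d.+1 * expR M.
Proof.
move=> g01; have /andP[g0 g1] := g01; rewrite heatE.
have cv : cvgn (series (heat_coeff gamma x y)) := is_cvg_heat (ltW g0).
apply: (@cvgr_to_le _ eventually _ _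
  (fun N => `|series (heat_coeff gamma x y) N - gamma ^+ d * d`!%:R|)
  `|limn (series (heat_coeff gamma x y)) - gamma ^+ d * d`!%:R|).
  exact: (cvg_norm (cvgB cv (cvg_cst (gamma ^+ d * d`!%:R)))).
near=> N; apply: heat_partial => //; near: N.
exact: nbhs_infty_gt.
Unshelve. all: by end_near. Qed.

Lemma heat_ratio_cvg x y :
  heat gamma 1 x y / gamma ^+ dist x y @[gamma --> (0 : R)^'+] -->
  ((dist x y)`!%:R : R).
Proof.
set d := dist x y.
have gM : (gamma * expR M @[gamma --> (0:R)^'+] --> (0:R)).
  apply: cvg_at_right_filter; rewrite -[X in _ --> X](mul0r (expR M)).
  by apply: cvgMl; exact: cvg_id.
apply: (@squeeze_cvgr _ _ _ _ (fun gamma => d`!%:R - gamma * expR M)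
   (fun gamma => d`!%:R + gamma * expR M)).
- near=> gamma.
  have g0 : 0 < gamma by near: gamma; exact: nbhs_right_gt.
  have g1 : gamma <= 1 by near: gamma; apply: nbhs_right_ltW.
  have := @heat_asymp gamma x y; rewrite -/d g0 g1 => /(_ isT).
  rewrite exprSr -mulrA ler_distl => /andP[h1 h2].
  have gd : 0 < gamma ^+ d by rewrite exprn_gt0.
  by rewrite ler_pdivlMr // ler_pdivrMr //; apply/andP; split; lra.
- rewrite -[X in _ --> X]subr0; apply: cvgB => //; exact: cvg_cst.
- rewrite -[X in _ --> X]addr0; apply: cvgD => //; exact: cvg_cst.
Unshelve. all: by end_near. Qed.

End HeatSeries.

(** * The limit coupling satisfies the switching relations *)

Section ZeroTemperature.
Variables (R : realType) (n kappa : nat).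
Local Notation X := (slice n kappa).
Implicit Types (x y : X).
Variables (nu0 nu1 : X -> R) (pi : X -> X -> R) (f g : R -> X -> R).
Hypothesis sys : forall gamma, 0 < gamma ->
  schrodinger_system nu0 nu1 gamma (f gamma) (g gamma).
Hypothesis lim_pi : forall x y,
  coupling_at gamma (f gamma) (g gamma) x y @[gamma --> 0^'+] --> pi x y.

Let p gamma x y := coupling_at gamma (f gamma) (g gamma) x y.
Let r gamma x y : R := heat gamma 1 x y / gamma ^+ dist x y.

Let unif_neq0 x : unif x != 0 :> R.
Proof.
rewrite /unif invr_eq0 pnatr_eq0 -lt0n; apply/card_gt0P.
by exists x.
Qed.

Let p_fst gamma x : 0 < gamma -> \sum_y p gamma x y = nu0 x.
Proof.
move=> g0; have [_ _ h _] := sys g0.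
transitivity (unif x * (f gamma x * heat_op gamma 1 (g gamma) x)).
  rewrite /heat_op !mulr_sumr; apply: eq_bigr => y _.
  by rewrite /p /coupling_at; ring.
by rewrite h mulrCA divff // mulr1.
Qed.

Let p_snd gamma y : 0 < gamma -> \sum_x p gamma x y = nu1 y.
Proof.
move=> g0; have [_ _ _ h] := sys g0.
transitivity (unif y * (g gamma y * heat_op gamma 1 (f gamma) y)).
  rewrite /heat_op !mulr_sumr; apply: eq_bigr => x _.
  by rewrite /p /coupling_at (heat_sym _ x y) /unif; ring.
by rewrite h mulrCA divff // mulr1.
Qed.

Lemma cvg_sumr (T : Type) (F : set_system T) (FF : Filter F) (I : finType)
    (u : I -> T -> R) (l : I -> R) : (forall i, u i s @[s --> F] --> l i) ->
  \sum_i u i s @[s --> F] --> \sum_i l i.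
Proof. by move=> ul; apply: cvg_big => //; exact: add_continuous. Qed.

Lemma zero_temp_fst x : \sum_y pi x y = nu0 x.
Proof.
apply: (@cvg_unique _ (@Rhausdorff R) (\sum_y p gamma x y @[gamma --> 0^'+])).
  by apply: cvg_sumr => y; exact: lim_pi.
apply: cvg_near_cst; near=> gamma; apply/p_fst; near: gamma.
exact: nbhs_right_gt.
Unshelve. all: by end_near. Qed.

Lemma zero_temp_snd y : \sum_x pi x y = nu1 y.
Proof.
apply: (@cvg_unique _ (@Rhausdorff R) (\sum_x p gamma x y @[gamma --> 0^'+])).
  by apply: cvg_sumr => x; exact: lim_pi.
apply: cvg_near_cst; near=> gamma; apply/p_snd; near: gamma.
exact: nbhs_right_gt.
Unshelve. all: by end_near. Qed.

Lemma zero_temp_ge0 x y : 0 <= pi x y.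
Proof.
apply: (@cvgr_to_ge _ (0^'+) _ _ (fun gamma => p gamma x y) (pi x y)).
  exact: lim_pi.
near=> gamma.
have g0 : 0 < gamma by near: gamma; exact: nbhs_right_gt.
have [f0 g0' _ _] := sys g0.
(* For small [gamma] the sign of the heat kernel is read off from its leading coefficient [d!]. *)
have r0 : 0 <= r gamma x y.
  near: gamma; apply: (cvgr_ge _ (@heat_ratio_cvg R n kappa x y)).
  by rewrite ltr0n fact_gt0.
rewrite /p /coupling_at !mulr_ge0 // ?invr_ge0 //.
by move: r0; rewrite /r pmulr_lge0 // invr_gt0 exprn_gt0.
Unshelve. all: by end_near. Qed.

(** The factors [f] and [g] are the same before and after exchanging [y] and [y']; only heat kernels
    and powers of [gamma] have to be balanced. *)
Let exchange gamma x y x' y' : 0 < gamma ->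
  p gamma x y * p gamma x' y' * (r gamma x y' * r gamma x' y)
    * gamma ^+ (dist x y' + dist x' y) =
  p gamma x y' * p gamma x' y * (r gamma x y * r gamma x' y')
    * gamma ^+ (dist x y + dist x' y').
Proof.
move=> g0; have gn k : gamma ^+ k != 0 by rewrite expf_neq0 // gt_eqF.
rewrite /p /coupling_at /r !exprD; field; by rewrite !gn.
Qed.

Let lim_exchange x y x' y' :
  p gamma x y * p gamma x' y' * (r gamma x y' * r gamma x' y)
    @[gamma --> 0^'+] -->
  pi x y * pi x' y' * ((dist x y')`!%:R * (dist x' y)`!%:R).
Proof.
by apply: cvgM; apply: cvgM; (exact: lim_pi || exact: heat_ratio_cvg).
Qed.

Lemma zero_temp_switching : switching pi.
Proof.
have f0 k : k`!%:R != 0 :> R by rewrite pnatr_eq0 -lt0n fact_gt0.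
split; first exact: zero_temp_ge0.
- move=> x y x' y' pxy pxy'; rewrite leqNgt; apply/negP => lt.
  suff : pi x y * pi x' y' * ((dist x y')`!%:R * (dist x' y)`!%:R) = 0.
    by apply/eqP; rewrite !mulf_neq0 // gt_eqF.
  apply: (@cvg_unique _ (@Rhausdorff R) (p gamma x y * p gamma x' y'
    * (r gamma x y' * r gamma x' y) @[gamma --> 0^'+])); first exact: lim_exchange.
  (* One less than the distance saved by the exchange: a factor [gamma] stays explicit and drives
     the limit to 0. *)
  pose m := ((dist x y + dist x' y') - (dist x y' + dist x' y)).-1%N.
  apply: (@cvg_trans _ (p gamma x y' * p gamma x' y
    * (r gamma x y * r gamma x' y') * (gamma ^+ m * gamma) @[gamma --> 0^'+])).
    apply: near_eq_cvg; near=> gamma.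
    have g0 : 0 < gamma by near: gamma; exact: nbhs_right_gt.
    have gn : gamma ^+ (dist x y' + dist x' y) != 0 by rewrite expf_neq0 // gt_eqF.
    have gE : gamma ^+ (dist x y + dist x' y') =
        gamma ^+ m * gamma * gamma ^+ (dist x y' + dist x' y).
      by rewrite -exprSr -exprD; congr (_ ^+ _); rewrite /m; lia.
    by apply: (mulIf gn); rewrite [RHS]exchange // gE [RHS]mulrA.
  have g0 : gamma ^+ m * gamma @[gamma --> (0 : R)^'+] --> (0 : R).
    rewrite -[X in _ --> X](mulr0 (0 ^+ m)); apply: cvg_at_right_filter.
    by apply: cvgM; [exact: exprn_continuous | exact: cvg_id].
  have := cvgM (@lim_exchange x y' x' y) g0; rewrite mulr0 => H; exact: H.
- move=> x y x' y' E.
  suff H : pi x y * pi x' y' * ((dist x y')`!%:R * (dist x' y)`!%:R) =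
           pi x y' * pi x' y * ((dist x y)`!%:R * (dist x' y')`!%:R).
    apply: (@mulIf _ (((dist x y')`!%:R * (dist x' y)`!%:R)
       * ((dist x y)`!%:R * (dist x' y')`!%:R))); first by rewrite !mulf_neq0.
    transitivity (pi x y * pi x' y' * ((dist x y')`!%:R * (dist x' y)`!%:R)).
      by field; rewrite !f0.
    by rewrite H; field; rewrite !f0.
  apply: (@cvg_unique _ (@Rhausdorff R) (p gamma x y * p gamma x' y'
    * (r gamma x y' * r gamma x' y) @[gamma --> 0^'+])); first exact: lim_exchange.
  apply: cvg_trans (@lim_exchange x y' x' y).
  apply: near_eq_cvg; near=> gamma.
  have g0 : 0 < gamma by near: gamma; exact: nbhs_right_gt.
  have gn : gamma ^+ (dist x y' + dist x' y) != 0 by rewrite expf_neq0 // gt_eqF.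
  by apply: (mulIf gn); rewrite [RHS]exchange // E.
Unshelve. all: by end_near. Qed.

End ZeroTemperature.

(** * Convexity from second derivatives inside the unit interval *)

Section Convexity.
Variable R : realType.
Implicit Types (f g : R -> R) (p : {poly R}) (s t : R).

(** Derivatives are asked only for inner times because masses may vanish at times 0 and 1, where
    [x ln x] is not differentiable; continuity carries inequalities to the end points. *)
Definition twice_derivable01 f f1 f2 : Prop :=
  continuous f /\ forall s, 0 < s < 1 ->
    is_derive s 1 f (f1 s) /\ is_derive s 1 f1 (f2 s).

Lemma convex01 f f1 f2 t : twice_derivable01 f f1 f2 ->
  (forall s, 0 < s < 1 -> 0 <= f2 s) -> 0 < t < 1 ->
  f t <= (1 - t) * f 0 + t * f 1.
Proof.
move=> [fc fd] f20 /andP[t0 t1].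
have in01 s : 0 < s -> s < 1 -> 0 < s < 1 by move=> -> ->.
have [||c1] := @MVT _ f f1 0 t t0.
- move=> s; rewrite in_itv /= => /andP[s0 st].
  by have [] := fd s (in01 s s0 (lt_trans st t1)).
- by apply: continuous_subspaceT.
rewrite in_itv /= => /andP[c10 c1t] E1.
have [||c2] := @MVT _ f f1 t 1 t1.
- move=> s; rewrite in_itv /= => /andP[s0 st].
  by have [] := fd s (in01 s (lt_trans t0 s0) st).
- by apply: continuous_subspaceT.
rewrite in_itv /= => /andP[c2t c21] E2.
have c12 := lt_trans c1t c2t.
have f1c s : 0 < s -> s < 1 -> is_derive s 1 f1 (f2 s).
  by move=> s0 s1; have [] := fd s (in01 s s0 s1).
have [||c3] := @MVT _ f1 f2 c1 c2 c12.
- move=> s; rewrite in_itv /= => /andP[s0 st].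
  by apply: f1c; [exact: lt_trans s0 | exact: lt_trans c21].
- apply: derivable_within_continuous => s; rewrite in_itv /= => /andP[s0 st].
  have [] // := f1c s; first exact: lt_le_trans s0.
  exact: le_lt_trans c21.
rewrite in_itv /= => /andP[c31 c32] E3.
have f3 : 0 <= f2 c3.
  by apply: f20; rewrite (lt_trans c10 c31) (lt_trans c32 c21).
have : 0 <= t * (1 - t) * (f1 c2 - f1 c1).
  rewrite E3 !mulr_ge0 // ?subr_ge0 ltW //.
have -> : t * (1 - t) * (f1 c2 - f1 c1) =
   t * (f1 c2 * (1 - t)) - (1 - t) * (f1 c1 * (t - 0)) by ring.
rewrite -E1 -E2; lra.
Qed.

Lemma twice_derivableZ f f1 f2 a : twice_derivable01 f f1 f2 ->
  twice_derivable01 (fun s => a * f s) (fun s => a * f1 s) (fun s => a * f2 s).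
Proof.
move=> [fc fd]; split => [s|s s01].
  by apply: cvgM; [exact: cvg_cst | exact: fc].
by have [d1 d2] := fd s s01; split; exact: is_deriveZ.
Qed.

Lemma twice_derivableD f f1 f2 g g1 g2 :
  twice_derivable01 f f1 f2 -> twice_derivable01 g g1 g2 ->
  twice_derivable01 (fun s => f s + g s) (fun s => f1 s + g1 s)
    (fun s => f2 s + g2 s).
Proof.
move=> [fc fd] [gc gd]; split => [s|s s01].
  by apply: cvgD; [exact: fc | exact: gc].
by have [d1 d2] := fd s s01; have [e1 e2] := gd s s01; split; exact: is_deriveD.
Qed.

Lemma twice_derivable_poly p :
  twice_derivable01 (horner p) (horner p^`()) (horner p^`()^`()).
Proof.
by split => [|s _]; [exact: continuous_horner | split; exact: is_derive_poly].
Qed.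

Lemma twice_derivable_sum (I : finType) (P : pred I) (f f1 f2 : I -> R -> R) :
  (forall i, P i -> twice_derivable01 (f i) (f1 i) (f2 i)) ->
  twice_derivable01 (fun s => \sum_(i | P i) f i s) (fun s => \sum_(i | P i) f1 i s)
    (fun s => \sum_(i | P i) f2 i s).
Proof.
move=> fd.
have zero : twice_derivable01 (fun=> 0) (fun=> 0) (fun=> 0).
  have := twice_derivableZ 0 (twice_derivable_poly 0).
  congr twice_derivable01; apply/funext => s; by rewrite mul0r.
rewrite /index_enum; elim: (Finite.enum _) => [|i r IH].
  by congr twice_derivable01: zero; apply/funext => s; rewrite big_nil.
have [Pi|nPi] := boolP (P i); last first.
  by congr twice_derivable01: IH; apply/funext => s; rewrite big_cons (negPf nPi).
congr twice_derivable01: (twice_derivableD (fd i Pi) IH);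
  by apply/funext => s; rewrite big_cons Pi.
Qed.

End Convexity.

(** * Regularity of [x ln x] up to and across 0 *)

Section XLnX.
Variable R : realType.
Implicit Types (p : {poly R}) (s t x : R).

Lemma xlnx_le x : `|x * ln x| <= 2 * Num.sqrt `|x| \/ 1 < x.
Proof.
have [x0|x0] := leP x 0; first by left; rewrite ln0 // mulr0 normr0 mulr_ge0.
have [x1|x1] := leP x 1; [left|by right].
rewrite normrM (gtr0_norm x0) ler0_norm; last by rewrite ln_le0.
set r := Num.sqrt x; have r0 : 0 < r by rewrite sqrtr_gt0.
have xr : x = r * r by rewrite -expr2 sqr_sqrtr // ltW.
have := @ln_sublinear R r^-1; rewrite invr_gt0 r0 lnV ?posrE // => /(_ isT) lnr.
rewrite {1 2}xr lnM ?posrE //.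
have -> : 2 * r = r * r * (2 * r^-1) by field; rewrite gt_eqF.
by rewrite ler_pM2l ?mulr_gt0 //; lra.
Qed.

(** Since [ln] is 0 on nonpositive numbers, the function vanishes there, and near 0 it is squeezed
    by the square root bound of [xlnx_le]. *)
Lemma continuous_xlnx : continuous (fun x : R => x * ln x).
Proof.
have sq : 2 * Num.sqrt `|x| @[x --> (0 : R)] --> (0 : R).
  have := cvgM (cvg_cst (2 : R)) (continuous_comp (@norm_continuous _ R 0)
    (@sqrt_continuous R _)).
  by rewrite /= normr0 sqrtr0 mulr0 => H; exact: H.
move=> x; have [x0|x0|->] := ltgtP x 0.
- apply: (near_cst_continuous 0); near=> y.
  have y0 : y <= 0.
    by near: y; apply: (cvgr_le x); [exact: cvg_id | exact: x0].
  by rewrite ln0 // mulr0.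
- by apply: cvgM; [exact: cvg_id | exact: continuous_ln].
rewrite /continuous_at ln0 // mulr0.
apply: (@squeeze_cvgr _ _ _ _ (fun x => - (2 * Num.sqrt `|x|))
   (fun x => 2 * Num.sqrt `|x|)) => //.
- near=> y; rewrite -ler_norml; have [//|] := xlnx_le y.
  rewrite ltNge => /negP[]; near: y.
  by apply: (cvgr_le (0 : R)); [exact: cvg_id | exact: ltr01].
- by rewrite -[X in _ --> X]oppr0; apply: cvgN.
Unshelve. all: by end_near. Qed.

Lemma twice_derivable_xlnx p :
  (forall s, 0 < s < 1 -> 0 < p.[s]) ->
  twice_derivable01 (fun s => p.[s] * ln p.[s])
    (fun s => p^`().[s] * (ln p.[s] + 1))
    (fun s => p^`()^`().[s] * (ln p.[s] + 1) + p^`().[s] ^+ 2 / p.[s]).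
Proof.
move=> p0; split => [s|s s01].
  apply: (@continuous_comp _ _ _ (horner p) (fun x => x * ln x)).
    exact: continuous_horner.
  exact: continuous_xlnx.
have ps := p0 s s01.
have dl : is_derive s 1 (fun u => ln p.[u]) (p.[s]^-1 * p^`().[s]).
  exact: (is_derive1_comp (is_derive1_ln ps) (is_derive_poly p s)).
split.
  have H := is_deriveM (is_derive_poly p s) dl; refine (is_derive_eq H _).
  by rewrite /GRing.scale /=; field; rewrite gt_eqF.
have dl1 : is_derive s 1 (fun u => ln p.[u] + 1) (p.[s]^-1 * p^`().[s] + 0).
  exact: (is_deriveD dl (is_derive_cst (1 : R) s 1)).
have H := is_deriveM (is_derive_poly p^`() s) dl1; refine (is_derive_eq H _).
by rewrite /GRing.scale /=; field; rewrite gt_eqF.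
Qed.

End XLnX.

(** * The entropy along the bridge as a function of time *)

Section BridgeEntropy.
Variables (R : realType) (n kappa : nat).
Local Notation X := (slice n kappa).
Implicit Types (x y z : X) (s t : R).
Variable pi : X -> X -> R.

Definition bridge_poly z : {poly R} :=
  \sum_(p : X * X) pi p.1 p.2 *: bridge_xy_poly R p.1 p.2 z.

Lemma horner_bridge z s : (bridge_poly z).[s] = bridge pi s z.
Proof.
rewrite /bridge_poly horner_sum -mean1; apply: eq_bigr => p _.
by rewrite hornerZ horner_bridge_xy mulr1 mulrC.
Qed.

Lemma deriv_bridge z s : 0 < s < 1 ->
  (bridge_poly z)^`().[s] = mean pi s z (drift s z).
Proof.
move=> s01; rewrite (big_morph _ (@derivD R) (@deriv0 R)) horner_sum.
apply: eq_bigr => p _; rewrite derivZ hornerZ deriv_bridge_xy //; ring.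
Qed.

Lemma deriv2_bridge z s : 0 < s < 1 ->
  (bridge_poly z)^`()^`().[s] = mean pi s z (accel s z).
Proof.
move=> s01; rewrite !(big_morph _ (@derivD R) (@deriv0 R)) horner_sum.
apply: eq_bigr => p _; rewrite 2!derivZ hornerZ deriv2_bridge_xy //; ring.
Qed.

Lemma bridge_start z : bridge pi 0 z = \sum_y pi z y.
Proof.
rewrite /bridge (bigD1 z) //= [X in _ + X]big1 ?addr0.
  by apply: eq_bigr => y _; rewrite bridge_xy_start eqxx mul1r.
move=> x xz; rewrite big1 // => y _.
by rewrite bridge_xy_start eq_sym (negPf xz) mul0r.
Qed.

Lemma bridge_stop z : bridge pi 1 z = \sum_x pi x z.
Proof.
rewrite /bridge; apply: eq_bigr => x _; rewrite (bigD1 z) //= big1 ?addr0.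
  by rewrite bridge_xy_stop eqxx mul1r.
by move=> y yz; rewrite bridge_xy_stop eq_sym (negPf yz) mul0r.
Qed.

Hypothesis swpi : switching pi.

Lemma bridge_xy_gt0 s x y z : 0 < s < 1 -> between x y z -> 0 < bridge_xy s x y z.
Proof.
case/andP => s0 s1 b; rewrite bridge_xy_fact //.
by rewrite !mulr_gt0 ?exprn_gt0 ?subr_gt0 // ?invr_gt0 ltr0n fact_gt0.
Qed.

(** All bridge weights are positive at inner times, so the support does not depend on time: each
    summand of the entropy is either identically 0 or smooth on the open interval. *)
Lemma bridge_poly_eq0 z s : 0 < s < 1 -> bridge pi s z = 0 -> bridge_poly z = 0.
Proof.
have [pi0 _ _] := swpi; move=> s01 Q0; rewrite /bridge_poly big1 // => -[x y] _ /=.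
have [b|b] := boolP (between x y z); last first.
  by rewrite /bridge_xy_poly (negPf b) mul0r scale0r scaler0.
move/eqP: Q0; rewrite -mean1 /mean psumr_eq0 => [/allP|p _]; last first.
  by rewrite mulr1; apply: mulr_ge0 => //; apply/bridge_xy_ge0/time_le01.
move/(_ (x, y) (mem_index_enum _)); rewrite /= mulr1 mulf_eq0 => /orP[/eqP h|/eqP->].
  by have := bridge_xy_gt0 s01 b; rewrite h ltxx.
by rewrite scale0r.
Qed.

Lemma twice_derivable_entropy (c : R) : 0 < c ->
  exists phi1, twice_derivable01
    (fun s => \sum_z bridge pi s z * ln (bridge pi s z / c)) phi1
    (fun s => \sum_z ((bridge_poly z)^`()^`().[s] * (ln (bridge pi s z / c) + 1)
       + (bridge_poly z)^`().[s] ^+ 2 / bridge pi s z)).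
Proof.
move=> c0; have c0' : c != 0 by rewrite gt_eqF.
pose phi z s := (bridge_poly z)^`().[s] * (ln (bridge pi s z / c) + 1).
exists (fun s => \sum_z phi z s).
apply: twice_derivable_sum => z _.
pose p := c^-1 *: bridge_poly z.
have pE s : p.[s] = bridge pi s z / c by rewrite hornerZ horner_bridge mulrC.
have [P0|P0] := eqVneq (bridge_poly z) 0.
  congr twice_derivable01: (twice_derivable_poly (0 : {poly R})); apply/funext => s.
  - by rewrite -horner_bridge P0 !horner0 mul0r.
  - by rewrite /phi P0 deriv0 !horner0 mul0r.
  - by rewrite P0 !deriv0 !horner0 mul0r expr0n mul0r addr0.
have p0 s : 0 < s < 1 -> 0 < p.[s].
  move=> s01; rewrite pE divr_gt0 // lt0r bridge_ge0 // andbT.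
  by apply: contra_neq P0 => /(bridge_poly_eq0 s01).
have := twice_derivableZ c (twice_derivable_xlnx p0).
congr twice_derivable01; apply/funext => s; rewrite pE.
- by rewrite mulrA mulrCA divff // mulr1.
- by rewrite /phi derivZ hornerZ mulrA mulrA divff // mul1r.
- rewrite !derivZ !hornerZ exprMn; have [->|Q0] := eqVneq (bridge pi s z) 0.
    by rewrite mul0r invr0; field.
  by field; rewrite Q0.
Qed.

(** For affine [q] the chain rule leaves only [h''], and [h'' u = 2 / (1 - u)]. *)
Lemma twice_derivable_h (q : {poly R}) :
  (forall s, 0 < s < 1 -> q.[s] < 1) -> q^`()^`() = 0 ->
  exists h1, twice_derivable01 (fun s => h q.[s]) h1
    (fun s => 2 * (q^`().[s] ^+ 2 / (1 - q.[s]))).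
Proof.
move=> q1 q2.
have p0 s : 0 < s < 1 -> 0 < (1 - q).[s] by rewrite !hornerE subr_gt0; exact: q1.
have H := twice_derivableD (twice_derivableZ 2 (twice_derivable_xlnx p0))
  (twice_derivableZ 2 (twice_derivable_poly q)).
have pE s : (1 - q).[s] = 1 - q.[s] by rewrite !hornerE.
have p1 : (1 - q)^`() = - q^`() by rewrite derivB -polyC1 derivC sub0r.
eexists; congr twice_derivable01: H; apply/funext => s //.
  by rewrite pE /h; ring.
by rewrite p1 derivN q2 oppr0 pE hornerN horner0 sqrrN; ring.
Qed.

End BridgeEntropy.

(** * Comparison functions and the displacement inequality *)

Section Displacement.
Variables (R : realType) (n kappa : nat).
Local Notation X := (slice n kappa).
Implicit Types (x y z : X) (s t : R).
Variables (nu0 nu1 : X -> R) (pi : X -> X -> R).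
Hypothesis nu0_prob : is_prob nu0.
Hypothesis swpi : switching pi.
Hypothesis pi_fst : forall x, \sum_y pi x y = nu0 x.
Hypothesis pi_snd : forall y, \sum_x pi x y = nu1 y.
Hypothesis kappa_range : (1 <= kappa <= n.-1)%N.

Let c : R := (#|{: X}|%:R)^-1.
Let phi s : R := \sum_z bridge pi s z * ln (bridge pi s z / c).
Let accel2 s : R := \sum_z (mean pi s z (accel s z) * (ln (bridge pi s z / c) + 1)
  + mean pi s z (drift s z) ^+ 2 / bridge pi s z).

Let c_gt0 : 0 < c.
Proof.
rewrite invr_gt0 ltr0n lt0n; have [_ mass] := nu0_prob.
apply: contra_eq_neq mass => /card0_eq X0.
by rewrite big_pred0 // eq_sym oner_neq0.
Qed.

Let phi0 : phi 0 = entropy nu0 unif.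
Proof. by apply: eq_bigr => z _; rewrite bridge_start pi_fst. Qed.

Let phi1 : phi 1 = entropy nu1 unif.
Proof. by apply: eq_bigr => z _; rewrite bridge_stop pi_snd. Qed.

Let compare (g g1 g2 : R -> R) t : twice_derivable01 g g1 g2 ->
  (forall s, 0 < s < 1 -> g2 s <= accel2 s) -> 0 < t < 1 ->
  phi t <= (1 - t) * phi 0 + t * phi 1 - ((1 - t) * g 0 + t * g 1 - g t).
Proof.
move=> gd g2le t01; have [phi' phid] := twice_derivable_entropy swpi c_gt0.
have := convex01 (twice_derivableD phid (twice_derivableZ (-1) gd)) _ t01.
have pos s : 0 < s < 1 -> 0 <= \sum_z ((bridge_poly pi z)^`()^`().[s] *
    (ln (bridge pi s z / c) + 1) + (bridge_poly pi z)^`().[s] ^+ 2 / bridge pi s z)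
    + -1 * g2 s.
  move=> s01; rewrite mulN1r subr_ge0; apply: le_trans (g2le s s01) _.
  rewrite le_eqVlt; apply/orP; left; apply/eqP; apply: eq_bigr => z _.
  by rewrite deriv2_bridge // deriv_bridge.
move/(_ pos); rewrite -/(phi t) -/(phi 0) -/(phi 1); lra.
Qed.

Let compare_const (K : R) t : (forall s, 0 < s < 1 -> K <= accel2 s) ->
  0 < t < 1 ->
  phi t <= (1 - t) * phi 0 + t * phi 1 - t * (1 - t) / 2 * K.
Proof.
(* The parabola with second derivative [K]; its convexity gap at [t] is [t (1 - t) / 2 * K]. *)
move=> Kle t01; pose q : {poly R} := (K / 2) *: 'X ^+ 2.
have qE s : q.[s] = K / 2 * s ^+ 2 by rewrite /q !hornerE.
have q2E s : q^`()^`().[s] = K.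
  by rewrite /q !derivZ derivXn derivMn derivX !hornerE; field.
apply: le_trans (compare (twice_derivable_poly q) _ t01) _ => [s s01|].
  by rewrite q2E Kle.
by rewrite !qE; lra.
Qed.

Let mass1 : \sum_(p : X * X) pi p.1 p.2 = 1.
Proof.
have [_ <-] := nu0_prob; rewrite -(pair_bigA _ (fun x y => pi x y)) /=.
by apply: eq_bigr => x _; rewrite pi_fst.
Qed.

Let cost : R := \sum_(p : X * X) pi p.1 p.2 * fdist R p.1 p.2.

Let W1_le : 0 <= W1 nu0 nu1 <= cost.
Proof.
have [pi0 _ _] := swpi.
have in_cost : exists2 q, is_coupling nu0 nu1 q &
    cost = \sum_x \sum_y (dist x y)%:R * q x y.
  exists pi => //; rewrite pair_bigA /=.
  by apply: eq_bigr => p _; rewrite mulrC.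
have lb0 (r : R) : (exists2 q, is_coupling nu0 nu1 q &
    r = \sum_x \sum_y (dist x y)%:R * q x y) -> 0 <= r.
  case=> q [q0 _ _] ->; apply: sumr_ge0 => x _; apply: sumr_ge0 => y _.
  by rewrite mulr_ge0.
apply/andP; split; first by apply: lb_le_inf; [exists cost | exact: lb0].
by apply: ge_inf; [exists 0; exact: lb0 | exact: in_cost].
Qed.

Let c2_le k : c2 k <= k%:R * (k%:R - 1) :> R.
Proof.
rewrite /c2; case: k => [|k]; first by rewrite !mul0r mulr0 expr0n subr0 maxxx.
have k1 : 1 <= k.+1%:R :> R by rewrite ler1n.
have ln0 : 0 <= ln (k.+1%:R : R) by rewrite ln_ge0.
have k0 : 0 <= k.+1%:R * (k.+1%:R - 1) :> R by rewrite mulr_ge0 ?subr_ge0.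
have kl : 0 <= k.+1%:R * ln (k.+1%:R : R) by rewrite mulr_ge0.
by rewrite ge_max mulr1; apply/andP; split; lra.
Qed.

Let m := minn kappa (n - kappa).

Let m_gt0 : (0 < m)%N. Proof. by rewrite /m; lia. Qed.

Let mE : m = kappa \/ m = (n - kappa)%N. Proof. by rewrite /m; lia. Qed.

Let convex_W1 t : 0 < t < 1 ->
  phi t <= (1 - t) * phi 0 + t * phi 1
    - t * (1 - t) / 2 * (4 / m%:R * W1 nu0 nu1 ^+ 2).
Proof.
apply: compare_const => s s01.
apply: le_trans (entropy_accel_cost s01 swpi c_gt0 m_gt0 mE mass1).
have /andP[w0 wc] := W1_le.
by rewrite ler_wpM2l ?divr_ge0 // ler_sqr // nnegrE // (le_trans w0).
Qed.

Let convex_Tc2 t : 0 < t < 1 ->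
  phi t <= (1 - t) * phi 0 + t * phi 1 - t * (1 - t) / 2 * (4 / m%:R * Tc2 pi).
Proof.
apply: compare_const => s s01; have [pi0 _ _] := swpi.
apply: le_trans (entropy_accel_dist2 s01 swpi c_gt0 m_gt0 mE).
rewrite ler_wpM2l ?divr_ge0 // /Tc2 pair_bigA /=.
by apply: ler_sum => p _; rewrite mulrC ler_wpM2l // c2_le.
Qed.

Let h0 : h 0 = 0 :> R.
Proof. by rewrite /h subr0 ln1 mulr0 addr0 mulr0. Qed.

(** The weight [nu x / 2] offsets the factor 2 in [h''], so that the second derivative has the form
    bounded in [entropy_accel_kernel]. *)
Let weighted_h (nu : X -> R) (q : X -> 'I_n -> {poly R}) (a : X -> bool) :
  (forall x i s, 0 < s < 1 -> (q x i).[s] < 1) ->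
  (forall x i, (q x i)^`()^`() = 0) ->
  exists g1, twice_derivable01
    (fun s => \sum_x nu x / 2 * \sum_(i | val x i == a x) h (q x i).[s]) g1
    (fun s => \sum_x nu x * \sum_(i | val x i == a x)
                (q x i)^`().[s] ^+ 2 / (1 - (q x i).[s])).
Proof.
move=> q1 q2.
pose g x i := projT1 (cid (twice_derivable_h (q1 x i) (q2 x i))).
have gd x i := projT2 (cid (twice_derivable_h (q1 x i) (q2 x i))).
exists (fun s => \sum_x nu x / 2 * \sum_(i | val x i == a x) g x i s).
apply: twice_derivable_sum => x _.
have H := twice_derivableZ (nu x / 2)
  (twice_derivable_sum (P := fun i => val x i == a x) (fun i _ => gd x i)).
congr twice_derivable01: H; apply/funext => s.
by rewrite -mulr_sumr; field.
Qed.

Let convex_Ttilde t : 0 < t < 1 ->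
  phi t <= (1 - t) * phi 0 + t * phi 1
    - t * (1 - t) / 2 * Ttilde nu0 nu1 t pi.
Proof.
move=> t01; have [pi0 _ _] := swpi.
have pick (F : X -> bool -> R) : exists a : X -> bool,
    forall x, Num.max (F x false) (F x true) = F x (a x).
  exists (fun x => F x false <= F x true) => x.
  by case: (leP (F x false)).
have [a aE] := pick (fun x b => \sum_(i | val x i == b) ht t (Pi_fwd nu0 pi i x)).
have [b bE] := pick (fun y b => \sum_(i | val y i == b) ht (1 - t) (Pi_bwd nu1 pi i y)).
pose u x i := Pi_fwd nu0 pi i x; pose v y i := Pi_bwd nu1 pi i y.
(* At time [s] these are the probabilities that coordinate [i] has moved, given the start [x], and
   that it has yet to move, given the end [y]. *)
pose qf x i : {poly R} := u x i *: 'X.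
pose qb y i : {poly R} := v y i *: (1 - 'X).
have qfE x i s : (qf x i).[s] = s * u x i by rewrite /qf !hornerE mulrC.
have qbE y i s : (qb y i).[s] = (1 - s) * v y i by rewrite /qb !hornerE mulrC.
have qf1 x i : (qf x i)^`() = (u x i)%:P by rewrite /qf derivZ derivX -alg_polyC.
have qb1 y i : (qb y i)^`() = (- v y i)%:P.
  by rewrite /qb derivZ derivB derivX -polyC1 derivC sub0r scalerN alg_polyC -polyCN.
have [||gf gfd] := @weighted_h nu0 qf a.
- move=> x i s s01; rewrite qfE -subr_gt0.
  exact: (kernel_den_gt0 pi0 pi_fst).
- by move=> x i; rewrite qf1 derivC.
have [||gb gbd] := @weighted_h nu1 qb b.
- move=> y i s s01; rewrite qbE -subr_gt0.
  apply: (@kernel_den_gt0 _ _ _ nu1 (fun y x => pi x y)) => //.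
  by case/andP: s01 => s0 s1; apply/andP; split; lra.
- by move=> y i; rewrite qb1 derivC.
apply: le_trans (compare (twice_derivableD gfd gbd) _ t01) _ => [s s01|].
  have := entropy_accel_kernel s01 swpi pi_fst pi_snd a b c_gt0.
  apply: le_trans; rewrite le_eqVlt; apply/orP; left; apply/eqP.
  congr (_ + _); apply: eq_bigr => x _; congr (_ * _); apply: eq_bigr => i _.
    by rewrite qf1 hornerC qfE.
  by rewrite qb1 hornerC qbE sqrrN.
rewrite lerD2l lerN2 le_eqVlt; apply/orP; left; apply/eqP.
have /andP[t0 t1] := t01; have t1' : 1 - t != 0 by rewrite gt_eqF // subr_gt0.
have t0' : t != 0 by rewrite gt_eqF.
have maxE (F : 'I_n -> R) (x : X) :
    Num.max (\sum_(i in J0 x) F i) (\sum_(j in J1 x) F j) =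
    Num.max (\sum_(i | val x i == false) F i) (\sum_(i | val x i == true) F i).
  by congr Num.max; apply: eq_bigl => i; rewrite inE; case: (val x i).
have part (nu : X -> R) (w : X -> 'I_n -> R) (d : X -> bool) (q : X -> 'I_n -> {poly R}) r0 :
    (forall x i, (1 - t) * h (q x i).[0] + t * h (q x i).[1] - h (q x i).[t] =
       t * (1 - t) * ht r0 (w x i)) ->
    (1 - t) * (\sum_x nu x / 2 * \sum_(i | val x i == d x) h (q x i).[0])
    + t * (\sum_x nu x / 2 * \sum_(i | val x i == d x) h (q x i).[1])
    - \sum_x nu x / 2 * \sum_(i | val x i == d x) h (q x i).[t] =
    t * (1 - t) / 2 * \sum_(x : X) (\sum_(i | val x i == d x) ht r0 (w x i)) * nu x.
  move=> qw; rewrite !mulr_sumr -big_split -sumrB; apply: eq_bigr => x _ /=.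
  transitivity (nu x / 2 * \sum_(i | val x i == d x) (t * (1 - t) * ht r0 (w x i))).
    rewrite -(eq_bigr _ (fun i _ => qw x i)) sumrB big_split -!mulr_sumr /=; ring.
  by rewrite -mulr_sumr; ring.
(* As [h 0 = 0], the convexity gap of [h] along these lines is the numerator of [ht]; seen from the
   end, the time elapsed is [1 - t]. *)
have Hb y i : (1 - t) * h (qb y i).[0] + t * h (qb y i).[1] - h (qb y i).[t] =
    t * (1 - t) * ht (1 - t) (v y i).
  rewrite !qbE subr0 subrr mul0r mul1r h0 /ht subKr.
  by field; rewrite t0' t1'.
have Hf x i : (1 - t) * h (qf x i).[0] + t * h (qf x i).[1] - h (qf x i).[t] =
    t * (1 - t) * ht t (u x i).
  by rewrite !qfE mul0r mul1r h0 /ht; field; rewrite t0' t1'.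
have Eb := part nu1 v b qb _ Hb; have Ea := part nu0 u a qf _ Hf.
have -> : Ttilde nu0 nu1 t pi =
    \sum_(x : X) (\sum_(i | val x i == a x) ht t (u x i)) * nu0 x
    + \sum_(y : X) (\sum_(i | val y i == b y) ht (1 - t) (v y i)) * nu1 y.
  by rewrite /Ttilde; congr (_ + _); apply: eq_bigr => x _; rewrite maxE ?aE ?bE.
rewrite mulrDr -Ea -Eb; ring.
Qed.

Lemma entropy_displacement t : 0 < t < 1 ->
  entropy (bridge pi t) unif <=
    (1 - t) * entropy nu0 unif + t * entropy nu1 unif
    - t * (1 - t) / 2 * Ct nu0 nu1 t pi.
Proof.
move=> t01; rewrite -phi0 -phi1 -[leLHS]/(phi t).
have max_cases (a b : R) (P : R -> Prop) : P a -> P b -> P (Num.max a b).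
  by move=> Pa Pb; case: leP.
pose P K := phi t <= (1 - t) * phi 0 + t * phi 1 - t * (1 - t) / 2 * K.
apply: (max_cases _ _ P); first exact: convex_W1.
by apply: (max_cases _ _ P); [exact: convex_Tc2 | exact: convex_Ttilde].
Qed.

End Displacement.

Theorem theorem2p7 (R : realType) (n kappa : nat)
  (hn : (2 <= n)%N) (hkappa : (1 <= kappa <= n.-1)%N)
  (nu0 nu1 : slice n kappa -> R)
  (hnu0 : is_prob nu0) (hnu1 : is_prob nu1)
  (pi : slice n kappa -> slice n kappa -> R)
  (hpi : zero_temp_coupling nu0 nu1 pi)
  (t : R) (ht01 : 0 < t < 1) :
  entropy (bridge pi t) unif <=
    (1 - t) * entropy nu0 unif + t * entropy nu1 unif
    - t * (1 - t) / 2 * Ct nu0 nu1 t pi.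
Proof.
have [f [g [sys lim]]] := hpi.
exact: (entropy_displacement hnu0 (zero_temp_switching sys lim)
  (zero_temp_fst sys lim) (zero_temp_snd sys lim) hkappa ht01).
Qed.
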